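(* Let $q$ be a power of a prime, let $\epsilon \in \{\pm 1\}$, and let $n \ge 1$ be an integer. For each integer $d\ge 1$ put $$\gamma_{\epsilon,q}(d) := \sum_{k=0}^{d-1} \xi_{q^d-\epsilon^d}^{(\epsilon q)^k}.$$ Then $$\mathbb{Q}(\mathrm{GL}^{\epsilon}_n(q)) = \mathbb{Q}(\{\gamma_{\epsilon,q}(d) : 1 \le d \le n\}).$$
   Context: For a finite group $G$, $\mathbb{Q}(G) := \mathbb{Q}(\{\chi(g) : \chi \in \mathrm{Irr}(G),\ g \in G\})$, where $\mathrm{Irr}(G)$ is the set of complex irreducible characters. For a positive integer $m$, $\xi_m := \exp(2\pi i/m) \in \mathbb{C}$. Notation: $\mathrm{GL}^{+1}_n(q) := \mathrm{GL}_n(q)$ is the general linear group over $\mathbb{F}_q$ and $\mathrm{GL}^{-1}_n(q) := \mathrm{GU}_n(q)$ is the general unitary group (a subgroup of $\mathrm{GL}_n(q^2)$). *)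

(* Defs.v *)
From HB Require Import structures.
From mathcomp Require Import all_boot all_order all_algebra all_fingroup.
From mathcomp Require Import all_solvable all_field all_character.

Set Implicit Arguments.
Unset Strict Implicit.
Unset Printing Implicit Defensive.

Import Order.TTheory GRing.Theory Num.Theory.

Local Open Scope ring_scope.

(* Q(S): the intersection of all subfields of algC containing S.  A subset of *)
(* a field is a subfield iff it contains 1 and is closed under differences    *)
(* and quotients (with x / 0 = 0).                                            *)
Definition Qadjoin (S : algC -> Prop) (x : algC) : Prop :=
  forall K : {pred algC},
    divring_closed K -> (forall y, S y -> y \in K) -> x \in K.

Definition char_value (gT : finGroupType) (G : {group gT}) (z : algC) : Prop :=
  exists (i : Iirr G) (g : gT), g \in G /\ z = 'chi_i g.

(* exp(2 pi i / m) for m > 0: the root m.-root (-1) is the m-th root of -1    *)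
(* with least nonnegative argument, namely exp(pi i / m) (also for m = 1).    *)
Definition xi (m : nat) : algC := (m.-root (-1)) ^+ 2.

(* The exponent (eps q)^k may be negative, hence the integer power.           *)
Definition gamma (eps : int) (q d : nat) : algC :=
  \sum_(k < d) xi `|q%:Z ^+ d - eps ^+ d|%N ^ ((eps * q%:Z) ^+ k).

(* MathComp's {'GL_n[F]} consists of matrices of size n.-1.+1, i.e. n when    *)
(* n > 0.                                                                     *)
Section UnitaryGroup.
Variables (n : nat) (F : finFieldType) (q : nat).

(* Hermitian when #|F| = q ^ 2, x |-> x ^+ q being then the involution of F.  *)
Definition herm_form (u v : 'rV[F]_n.-1.+1) : F :=
  \sum_i u 0 i * v 0 i ^+ q.

Definition GU : {set {'GL_n[F]}} :=
  [set g : {'GL_n[F]} | [forall u, forall v,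
     herm_form (u *m GLval g) (v *m GLval g) == herm_form u v]].

Lemma GU_group_set : group_set GU.
Proof.
apply/group_setP; split=> [|g h].
  by rewrite inE; apply/forallP=> u; apply/forallP=> v; rewrite !mulmx1.
rewrite !inE => /forallP gP /forallP hP; apply/forallP=> u; apply/forallP=> v.
rewrite !mulmxA (eqP (forallP (hP _) _)).
exact: (forallP (gP u) v).
Qed.

Canonical GU_group := Group GU_group_set.

End UnitaryGroup.

(* GL^eps_n(q) is a group of matrices over a field with this many elements.   *)
Definition GLeps_card (eps : int) (q : nat) : nat :=
  if eps == 1 then q else (q ^ 2)%N.

Definition GLeps (eps : int) (n : nat) (F : finFieldType) (q : nat) :
    {group {'GL_n[F]}} :=
  if eps == 1 then 'GL_n[F]%G else GU_group n F q.

(* Main.v *)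
From HB Require Import structures.
Require Import Defs.
From mathcomp Require Import all_boot all_order all_algebra all_fingroup.
From mathcomp Require Import all_solvable all_field all_character.
From mathcomp Require Import ring lra zify.

(** Put Q = eps q and M_d = |Q^d - 1| = |q^d - eps^d|, and let N be a common
multiple of |G| and of M_1, ..., M_n, where G = GL^eps_n(q).  Both fields lie in
Q(zeta_N), whose automorphisms sigma_k raise the N-th roots of unity to the k-th
power, k prime to N.  By Galois theory it is enough that the two fields have the
same stabilizer, and both stabilizers turn out to consist of the k such that

  for all d <= n, k is congruent to a power of Q modulo M_d.       (1)

Gaussian periods.  The sum gamma(d) runs over the orbit of a primitive M_d-th
root of unity under x |-> x^Q, so (1) implies that sigma_k fixes it.  Conversely
a linear relation between primitive M-th roots of unity splits into relations
between roots whose exponents agree modulo r^max(1, v_r(M)-1) for every prime r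
dividing M ([relation_split]).  A power of Q is congruent to 1 for all these
moduli only if it is 1 modulo M_d ([powers_split]), so the relation
sigma_k(gamma(d)) = gamma(d) leaves a relation between two roots of unity only,
which says that k is a power of Q.  The argument fails for (Q, d) = (-3, 2) and
(-2, 3), where gamma(d) is 0, and there gamma(1) decides ([periods_stab]).

Character values.  As sigma_k(chi(g)) = chi(g^k), the automorphism sigma_k fixes
all character values if and only if g^k is conjugate to g for every g in G.

(1) implies conjugacy.  Over a field, two matrices A and B are similar as soon
as f^m(A) and f^m(B) have the same rank for all irreducible f and all m
([primary_rank_similar]).  An eigenvalue x of g in G has an orbit under
x |-> x^Q consisting of eigenvalues, so of length some d <= n; hence x^M_d = 1,
and x^k lies in this orbit by (1).  This gives the ranks, for g and g^k
([power_similar]).  Unitary matrices that are similar are conjugate in the unitary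
group: this reduces to writing a Hermitian unit a as y * star y with y in the
double centralizer of a, which is Hilbert's Theorem 90 followed by a count
([hermitian_norm], [unitary_conj]).

Conjugacy implies (1).  For d <= n there is a g in G whose eigenvalues are 1 and
the orbit of a primitive M_d-th root of unity z under x |-> x^Q.  It is obtained
from a diagonal matrix over an extension by a Vandermonde matrix
([orbit_element]); in the unitary case, it is then similar to its inverse
conjugate transpose, and it therefore preserves a nondegenerate Hermitian form,
which is equivalent to the standard one ([unitary_form]).  If g^k is conjugate
to g, then z^k is an eigenvalue of g, that is z^(Q^j) for some j. *)

Set Implicit Arguments.
Unset Strict Implicit.
Unset Printing Implicit Defensive.

Import Order.TTheory GRing.Theory Num.Theory.

Local Open Scope ring_scope.

(** * The root of unity xi m is primitive *)

(** The points (a, b) and (c, s) are on the upper unit circle and (c, s) is at least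
as close to 1: then the rotation that takes (c, s) to 1 keeps (a, b) in the
upper half plane and moves it closer to 1. *)
Lemma unit_circle_step (R : realFieldType) (a b c s : R) :
  a ^+ 2 + b ^+ 2 = 1 -> c ^+ 2 + s ^+ 2 = 1 -> 0 <= b -> 0 <= s ->
  a <= c -> c < 1 -> 0 <= b * c - a * s /\ a < a * c + b * s.
Proof.
move=> ab cs b0 s0 ac c1.
have sle : 0 <= a -> s <= b.
  move=> a0; rewrite -(@ler_pXn2r _ 2) ?nnegrE //; nra.
have bls : c <= 0 -> b <= s.
  move=> c0; rewrite -(@ler_pXn2r _ 2) ?nnegrE //; nra.
split.
  case: (lerP 0 c) => c0; last by have := bls (ltW c0); nra.
  case: (lerP 0 a) => a0; [by have := sle a0; nra | nra].
case: (ltrP 0 a) => a0.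
  have := sle (ltW a0) => sb; have : s ^+ 2 <= b * s by nra.
  nra.
have bs0 : 0 <= b * s by nra.
case: (ltrP a 0) => a1; first by nra.
have a00 : a = 0 by apply/eqP; rewrite eq_le a0 a1.
subst a; have b1 : b = 1 by nra.
subst b.
have : s != 0 by apply/eqP => s00; subst s; nra.
rewrite lt0r; nra.
Qed.

Lemma norm_root_unity N (y : algC) : (0 < N)%N -> y ^+ N = 1 -> `|y| = 1.
Proof.
move=> N0 yN; apply/eqP; rewrite -(@pexpr_eq1 _ _ N) //.
by rewrite -normrX yN normr1.
Qed.

(** Real and imaginary parts in the totally ordered field of real algebraic
numbers. *)
Definition rRe (z : algC) : algR := in_algR (Creal_Re z).
Definition rIm (z : algC) : algR := in_algR (Creal_Im z).

Lemma rRe_inj_on N (y z : algC) : (0 < N)%N -> y ^+ N = 1 -> z ^+ N = 1 ->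
  0 <= rIm y -> 0 <= rIm z -> rRe y = rRe z -> y = z.
Proof.
move=> N0 /norm_root_unity-/(_ N0) ny /norm_root_unity-/(_ N0) nz iy iz.
move/(congr1 algRval) => /= eR.
have := normC2_Re_Im y; rewrite ny -nz normC2_Re_Im eR => /addrI /eqP.
rewrite (@eqrXn2 _ 2) // => /eqP eI.
by rewrite [y]Crect [z]Crect eR eI.
Qed.

Lemma unit_circle N (y : algC) : (0 < N)%N -> y ^+ N = 1 ->
  rRe y ^+ 2 + rIm y ^+ 2 = 1.
Proof.
move=> N0 /norm_root_unity-/(_ N0) ny; apply/val_inj => /=.
by rewrite -!expr2 -normC2_Re_Im ny expr1n.
Qed.

Lemma rRe_lt1 N (y : algC) : (0 < N)%N -> y ^+ N = 1 -> y != 1 -> rRe y < 1.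
Proof.
move=> N0 yN; apply: contraR; rewrite -leNgt => h.
have u := unit_circle N0 yN.
have i0 : rIm y = 0 by apply/eqP; rewrite -sqrf_eq0; apply/eqP; nra.
have r1 : rRe y = 1 by move: u; rewrite i0; nra.
apply/eqP; rewrite [y]Crect.
by rewrite [_ y](congr1 algRval r1) [X in 'i * X](congr1 algRval i0) mulr0 addr0.
Qed.

(** The nontrivial root of unity closest to 1 generates: dividing by it brings any root
in the upper half plane closer to 1, so that finitely many divisions reach 1. *)
Lemma closest_root N : (1 < N)%N -> exists rho : algC,
  [/\ N.-primitive_root rho, 0 <= 'Im rho &
      forall y, y ^+ N = 1 -> y != 1 -> 'Re y <= 'Re rho].
Proof.
move=> N1; have N0 := ltnW N1.
have [z pz] := C_prim_root_exists N0.
have [rho [rN rho1 Ir Rr]] : exists rho : algC, [/\ rho ^+ N = 1, rho != 1,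
    0 <= rIm rho & forall y, y ^+ N = 1 -> y != 1 -> rRe y <= rRe rho].
  pose i0 : 'I_N := Ordinal N1.
  have zi i : (z ^+ i) ^+ N = 1 by rewrite exprAC (prim_expr_order pz) expr1n.
  case: (@arg_maxP _ _ _ i0 [pred i : 'I_N | z ^+ i != 1] (fun i => rRe (z ^+ i))).
    by rewrite /= -(prim_order_dvd pz) gtnNdvd.
  move=> i /= zi1 imax.
  have mx y : y ^+ N = 1 -> y != 1 -> rRe y <= rRe (z ^+ i).
    by move=> /(prim_rootP pz)[j ->] /imax.
  case: (lerP 0 (rIm (z ^+ i))) => I0; first by exists (z ^+ i); split.
  exists (z ^+ i)^*; split.
  - by rewrite -rmorphXn zi rmorph1.
  - by rewrite -(inj_eq (inv_inj (@conjCK _))) conjCK rmorph1.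
  - have/ltW Ine : 'Im (z ^+ i) < 0 := I0.
    by change (0 <= 'Im (z ^+ i)^*); rewrite Im_conj oppr_ge0.
  - move=> y yN y1; apply: le_trans (mx y yN y1) _.
    by change ('Re (z ^+ i) <= 'Re (z ^+ i)^*); rewrite Re_conj.
exists rho; split; [|exact: Ir|by move=> y yN y1; exact: Rr].
(* induction on the number of roots of larger real part than y *)
have gen y : y ^+ N = 1 -> 0 <= rIm y -> exists k, y = rho ^+ k.
  move: {2}_.+1 (ltnSn #|[pred i : 'I_N | rRe y < rRe (z ^+ i)]|) => m.
  elim: m y => // m IH y ltm yN Iy.
  have [->|y1] := eqVneq y 1; first by exists 0%N.
  have [I' R'] := unit_circle_step (unit_circle N0 yN) (unit_circle N0 rN) Iy Ir (Rr _ yN y1) (rRe_lt1 N0 rN rho1).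
  have rV : rho^* * rho = 1 by rewrite mulrC -normCK (norm_root_unity N0 rN) expr1n.
  have y'N : (y * rho^*) ^+ N = 1 by rewrite exprMn yN -rmorphXn rN rmorph1 mulr1.
  have Re' : rRe (y * rho^*) = rRe y * rRe rho + rIm y * rIm rho.
    by apply/val_inj; rewrite /= ReM Re_conj Im_conj mulrN opprK.
  have Im' : rIm (y * rho^*) = rIm y * rRe rho - rRe y * rIm rho.
    by apply/val_inj; rewrite /= ImM Re_conj Im_conj mulrN addrC mulrC.
  have [|||k Dk] := IH (y * rho^*) => //; [|by rewrite Im'|].
    rewrite -ltnS; apply: leq_trans ltm; rewrite ltnS; apply: proper_card; apply/properP; split.
      by apply/subsetP=> i; rewrite !inE; apply: lt_trans; rewrite Re'.
    have [i Di] := prim_rootP pz y'N.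
    by exists i; rewrite !inE -Di ?ltxx // Re'.
  by exists k.+1; rewrite exprSr -Dk -mulrA rV mulr1.
have [m pm mN] := prim_order_exists N0 rN.
suff : (N %| m)%N by move=> Nm; have/eqP <- : m == N by rewrite eqn_dvd mN Nm.
rewrite (prim_order_dvd pz).
case: (lerP 0 (rIm z)) => I0.
  have [k ->] := gen z (prim_expr_order pz) I0.
  by rewrite exprAC (prim_expr_order pm) expr1n.
have [||k Dk] := gen z^*.
- by rewrite -rmorphXn (prim_expr_order pz) rmorph1.
- have/ltW Ine : 'Im z < 0 := I0.
  by change (0 <= 'Im z^*); rewrite Im_conj oppr_ge0.
by rewrite -[z]conjCK Dk -!rmorphXn exprAC (prim_expr_order pm) expr1n rmorph1.
Qed.

(** The principal m-th root of -1 is defined by an extremal property, as the root in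
the upper half plane with largest real part.  The 2m-th root of unity closest
to 1 satisfies the same property, and it is primitive. *)
Lemma xi_prim m : (0 < m)%N -> m.-primitive_root (xi m).
Proof.
move=> m0; have [->|m1] : m = 1%N \/ (1 < m)%N by lia.
  rewrite /xi root1C sqrrN expr1n; apply/andP; split=> //.
  by apply/forallP=> i; rewrite ord1 unity_rootE expr1n eqxx.
have [//|rho [pr Ir Rr]] := @closest_root m.*2; first by lia.
have rm : rho ^+ m = -1.
  have/eqP := prim_expr_order pr; rewrite -muln2 exprM -subr_eq0 subr_sqr_1.
  rewrite mulf_eq0 subr_eq0 addr_eq0 => /orP[|/eqP //].
  by rewrite -(prim_order_dvd pr) gtnNdvd //; lia.
pose w : algC := m.-root (-1).
have wm : w ^+ m = -1 by rewrite rootCK.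
have w1 : w != 1 by apply/eqP=> w1; move: wm; rewrite w1 expr1n => /eqP;
  rewrite -subr_eq0 opprK -(natrD _ 1 1) pnatr_eq0.
have w2 : w ^+ m.*2 = 1 by rewrite -muln2 exprM wm sqrrN expr1n.
have Rw : 'Re w = 'Re rho.
  by apply/eqP; rewrite eq_le Rr // rootC_Re_max.
have -> : xi m = rho ^+ 2.
  rewrite /xi -/w; congr (_ ^+ 2); apply: (@rRe_inj_on m.*2) => //.
  - by rewrite double_gt0.
  - exact: prim_expr_order.
  - exact: Im_rootC_ge0.
  - exact/val_inj.
have := exp_prim_root pr 2; have -> : gcdn 2 m.*2 = 2.
  by apply/gcdn_idPl; rewrite dvdn2 odd_double.
by rewrite -muln2 mulnK.
Qed.

(** * Splitting linear relations between primitive roots of unity *)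

Lemma eqn_modMr r e s t : coprime r e -> (s * e == t * e %[mod r]) = (s == t %[mod r]).
Proof.
move=> cre; wlog st : s t / (s <= t)%N.
  by move=> W; case/orP: (leq_total s t) => /W // E; rewrite eq_sym E eq_sym.
rewrite eq_sym [RHS]eq_sym !eqn_mod_dvd ?leq_mul2r ?st ?orbT //.
by rewrite -mulnBl Gauss_dvdl.
Qed.

(** Orthogonality of the characters of Z/B. *)
Lemma sum_prim_expr B (w : algC) m : B.-primitive_root w ->
  \sum_(s < B) w ^+ (s * m) = if (B %| m)%N then B%:R else 0.
Proof.
move=> pw; have [Bm|nBm] := boolP (B %| m)%N.
  rewrite (eq_bigr (fun=> 1)) => [|s _]; last by apply/eqP;
    rewrite -(prim_order_dvd pw) dvdn_mull.
  by rewrite sumr_const card_ord.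
have w1 : w ^+ m - 1 != 0 by rewrite subr_eq0 -(prim_order_dvd pw).
apply: (mulfI w1); rewrite mulr0 (eq_bigr (fun s : 'I_B => (w ^+ m) ^+ s)) => [|s _].
  by rewrite -subrX1 exprAC (prim_expr_order pw) expr1n subrr.
by rewrite mulnC exprM.
Qed.

Section Split.
Variables (M : nat) (z : algC).
Hypothesis pz : M.-primitive_root z.

(** For a prime r dividing M: the r-part of M divided by r, but r itself if r divides M
only once. *)
Definition split_mod r := (r ^ maxn 1 (logn r M).-1)%N.

Lemma galois_relation (I : finType) (c : I -> algC) (u : I -> nat) k :
  (forall i, c i \in Crat) -> coprime k M ->
  \sum_i c i * z ^+ u i = 0 -> \sum_i c i * z ^+ (k * u i) = 0.
Proof.
move=> cQ /Qn_aut_exists[nu nuE] /(congr1 nu); rewrite rmorph0 rmorph_sum /= => S0;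
  rewrite -[RHS]S0.
apply: eq_bigr => i _; rewrite rmorphM rmorphXn aut_Crat // nuE ?(prim_expr_order pz) //.
by rewrite exprM.
Qed.

(** Let E = M / B with B the modulus attached to r.  The exponents 1 + s E, for s < B,
give Galois conjugates of the relation, whose average against the characters of
Z/B isolates a residue class.  When r^2 divides M all these exponents are prime
to M; when it does not, exactly one value of s fails, but the corresponding
equation follows from the others because no exponent u i is divisible by r. *)
Lemma relation_split_prime (I : finType) (c : I -> algC) (u : I -> nat) y r :
  prime r -> (r %| M)%N -> (forall i, c i \in Crat) -> (forall i, coprime (u i) M) ->
  \sum_i c i * z ^+ u i = 0 ->
  \sum_(i | u i == y %[mod split_mod r]) c i * z ^+ u i = 0.
Proof.
move=> pr rM cQ uM S0; set B := split_mod r.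
have M0 := prim_order_gt0 pz.
have [N cN DM] := pfactor_coprime pr M0.
have a0 : (0 < logn r M)%N by rewrite logn_gt0 mem_primes pr M0 rM.
have B0 : (0 < B)%N by rewrite expn_gt0 prime_gt0.
have BM : (B %| M)%N.
  by rewrite (dvdn_trans _ (pfactor_dvdnn r M)) // dvdn_exp2l //; lia.
set E := (M %/ B)%N.
have DE : (E * B = M)%N by rewrite divnK.
have pw : B.-primitive_root (z ^+ E) by apply: dvdn_prim_root.
pose G s := \sum_i c i * z ^+ u i * (z ^+ E) ^+ (s * u i).
have Gavg y0 : \sum_(s < B) G s * (z ^+ E) ^+ (s * (y0 * B.-1)) =
    B%:R * \sum_(i | u i == y0 %[mod B]) c i * z ^+ u i.
  under eq_bigr do rewrite mulr_suml; rewrite exchange_big /= mulr_sumr.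
  rewrite [RHS]big_mkcond; apply: eq_bigr => i _.
  under eq_bigr do rewrite -mulrA -exprD -mulnDr.
  rewrite -mulr_sumr (sum_prim_expr _ pw).
  have -> : (B %| u i + y0 * B.-1)%N = (u i == y0 %[mod B]).
    rewrite /dvdn -[0%N in LHS](mod0n B) -(eqn_modDr y0) add0n.
    by rewrite -addnA -mulnSr prednK // addnC modnMDl.
  by case: ifP => _; rewrite ?mulr0 // mulrC.
have Gk s : coprime (1 + s * E) M -> G s = 0.
  move=> ck; rewrite -(galois_relation cQ ck S0); apply: eq_bigr => i _.
  by rewrite mulnDl mul1n exprD mulrA -exprM; congr (_ * z ^+ _); lia.
have cE s : coprime (1 + s * E) E by rewrite coprime_sym /coprime addnC gcdnMDl gcdn1.
have G0 s : (s < B)%N -> G s = 0.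
  move=> sB; have [ck|nck] := boolP (coprime (1 + s * E) M); first exact: Gk.
  have [a1|a1] : logn r M = 1%N \/ (1 < logn r M)%N by lia.
    have DB : B = r by rewrite /B /split_mod a1.
    have DEN : E = N by rewrite /E DB DM a1 expn1 mulnK // prime_gt0.
    have nr : (r %| 1 + s * E)%N.
      apply: contraNT nck; rewrite -prime_coprime // coprime_sym => cr.
      by rewrite -DE coprimeMr cE DB.
    (* the class of 0 is empty, so that G s is minus the sum of the other terms *)
    have := Gavg 0%N; rewrite (bigD1 (Ordinal sB)) //= mul0n muln0 expr0 mulr1.
    rewrite big1 ?addr0 => [->|t ts].
      rewrite big_pred0 ?mulr0 // => i; apply/negP => ui.
      have : (r %| gcdn (u i) M)%N by rewrite dvdn_gcd rM andbT /dvdn -DB (eqP ui) mod0n.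
      by rewrite (eqP (uM i)) dvdn1 => /eqP r1; rewrite r1 in pr.
    rewrite Gk ?mul0r // -DE coprimeMr cE /= [X in coprime _ X]DB coprime_sym prime_coprime //.
    apply: contra ts => rt; apply/eqP/val_inj/eqP => /=.
    have: (1 + t * E == 1 + s * E %[mod r])%N by move: nr rt; rewrite /dvdn => /eqP-> /eqP->.
    by rewrite eqn_modDl eqn_modMr ?DEN // !modn_small -?DB // => /eqP.
  have EN : E = (N * r)%N.
    apply/eqP; rewrite eq_sym eqn_div // [X in _ == X]DM -mulnA -expnS; apply/eqP;
      congr (_ * _ ^ _)%N.
    by lia.
  case/negP: nck; rewrite -DE coprimeMr cE /= coprime_sym coprimeXl //.
  by rewrite prime_coprime // EN mulnA dvdn_addl ?dvdn_mull // Euclid_dvd1.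
have := Gavg y; rewrite big1 => [/esym/eqP|s _]; last by rewrite G0 ?mul0r.
by rewrite mulf_eq0 pnatr_eq0 -leqn0 leqNgt B0 => /eqP.
Qed.

Definition split_eq x y := all (fun r => x == y %[mod split_mod r]) (primes M).

(** A class of a relation is again a relation, so the primes can be treated one by one. *)
Lemma relation_split (I : finType) (c : I -> algC) (u : I -> nat) y :
  (forall i, c i \in Crat) -> (forall i, coprime (u i) M) ->
  \sum_i c i * z ^+ u i = 0 ->
  \sum_(i | split_eq (u i) y) c i * z ^+ u i = 0.
Proof.
move=> cQ uM S0; suff gen rs : all (mem (primes M)) rs ->
    \sum_(i | all (fun r => u i == y %[mod split_mod r]) rs) c i * z ^+ u i = 0.
  by apply: gen; apply/allP.
elim: rs => [|r rs IH] /=; first by rewrite S0.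
rewrite mem_primes => /andP[/and3P[pr _ rM] /IH {IH}]; rewrite big_mkcond /= => {}S0.
pose c' i := if all (fun r => u i == y %[mod split_mod r]) rs then c i else 0.
have c'Q i : c' i \in Crat by rewrite /c'; case: ifP; rewrite ?rpred0.
have c'0 : \sum_i c' i * z ^+ u i = 0.
  by rewrite -[RHS]S0; apply: eq_bigr => i _; rewrite /c'; case: ifP; rewrite ?mul0r.
rewrite big_mkcondr -[RHS](relation_split_prime y pr rM c'Q uM c'0).
by apply: eq_bigr => i _; rewrite /c'; case: ifP; rewrite ?mul0r.
Qed.

(** If the powers of a inject into the residues modulo the splitting moduli, then the
class of 1 in the relation that expresses stability contains only z, from the left,
and at most one power z^(k a^i), from the right, up to multiplicity. *)
Lemma period_stab a k d : (0 < d)%N -> coprime a M -> coprime k M -> a ^ d = 1 %[mod M] ->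
  (forall i, split_eq (a ^ i) 1 -> a ^ i = 1 %[mod M]) ->
  \sum_(i < d) z ^+ (a ^ i) = \sum_(i < d) z ^+ (k * a ^ i) ->
  exists j, k = a ^ j %[mod M].
Proof.
move=> d0 ca ck ad aP /eqP; rewrite -subr_eq0 => /eqP S0.
pose c (i : 'I_d + 'I_d) : algC := if i is inl _ then 1 else -1.
pose u (i : 'I_d + 'I_d) : nat := match i with inl i => a ^ i | inr i => k * a ^ i end%N.
have cQ i : c i \in Crat by case: i => i /=; rewrite ?rpredN ?rpred1.
have uM i : coprime (u i) M by case: i => i /=; rewrite ?coprimeMl ?ck coprimeXl.
have Z0 : \sum_i c i * z ^+ u i = 0.
  rewrite big_sumType /= -[RHS]S0 -sumrN; congr (_ + _); apply: eq_bigr => i _.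
    by rewrite mul1r.
  by rewrite mulN1r.
have := relation_split 1 cQ uM Z0; rewrite big_sumType /=.
rewrite (eq_bigr (fun=> z)) => [|i /aP ai]; last first.
  by rewrite mul1r -(prim_expr_mod pz) ai (prim_expr_mod pz).
rewrite sumr_const; set m1 := #|_|.
have m1_gt0 : (0 < m1)%N.
  by apply/card_gt0P; exists (Ordinal d0); rewrite unfold_in /= expn0; apply/allP.
have z0 : z != 0 by apply: contraTneq (prim_order_gt0 pz) => z0; have := prim_expr_order pz;
  rewrite z0 expr0n; case: (M) => //= m /esym/eqP; rewrite oner_eq0.
case: (pickP (fun i : 'I_d => split_eq (k * a ^ i) 1)) => [i0 ki0|none]; last first.
  rewrite [X in _ + X]big_pred0 // addr0 => /eqP.
  by rewrite -mulr_natr mulf_eq0 (negPf z0) pnatr_eq0 -leqn0 leqNgt m1_gt0.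
have spl x y : split_eq (k * a ^ x) 1 -> split_eq (k * a ^ y) 1 -> (x <= y)%N -> a ^ y = a ^ x %[mod M].
  move=> /allP kx /allP ky xy; rewrite -(subnK xy) expnD.
  rewrite -modnMml aP ?modnMml ?mul1n //; apply/allP => r rM.
  have cr b : coprime b M -> coprime (split_mod r) b.
    move: rM; rewrite mem_primes => /and3P[pr M0 rM] cb; rewrite coprime_sym.
    by rewrite coprimeXr // (coprime_dvdr rM).
  have : k * a ^ y == k * a ^ x %[mod split_mod r] by rewrite (eqP (ky r rM)) (eqP (kx r rM)).
  rewrite -{1}(subnK xy) expnD mulnCA -[X in _ == X %[mod _]]mul1n eqn_modMr //.
  by rewrite cr // coprimeMl ck coprimeXl.
rewrite (eq_bigr (fun=> - z ^+ (k * a ^ i0))) => [|i ki]; last first.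
  rewrite mulN1r; congr (- _); apply/eqP; rewrite (eq_prim_root_expr pz).
  case/orP: (leq_total i i0) => ii; last by rewrite -modnMmr (spl _ _ ki0 ki ii) modnMmr.
  by rewrite eq_sym -modnMmr (spl _ _ ki ki0 ii) modnMmr.
rewrite sumr_const; set m2 := #|_| => /eqP; rewrite mulNrn subr_eq0 => /eqP E.
have nz i : `|z ^+ i| = 1.
  have M0 := prim_order_gt0 pz.
  apply/eqP; rewrite -(@pexpr_eq1 _ _ M) // -normrX exprAC (prim_expr_order pz) expr1n.
  by rewrite normr1.
have m12 : m1 = m2.
  have := congr1 Num.norm E; rewrite !normrMn nz -[z]expr1 nz => /eqP.
  by rewrite eqr_nat => /eqP.
have m1N0 : m1%:R != 0 :> algC by rewrite pnatr_eq0 -lt0n.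
move: E; rewrite -m12 -(mulr_natr z) -(mulr_natr (z ^+ _)) => /(mulIf m1N0)/eqP.
rewrite -{1}[z]expr1 (eq_prim_root_expr pz).
move=> /eqP E; exists (d - i0)%N.
have := congr1 (fun x => (x * a ^ (d - i0)) %% M)%N E; rewrite !modnMml mul1n => ->.
rewrite -mulnA -expnD subnKC ?(ltnW (ltn_ord i0)) //.
by rewrite -modnMmr ad modnMmr muln1.
Qed.
End Split.

(** * Stabilizers of the periods *)

Lemma split_mod_dvd M r : r \in primes M -> (split_mod M r %| M)%N.
Proof.
rewrite mem_primes => /and3P[pr M0 rM];
  rewrite (dvdn_trans _ (pfactor_dvdnn r M)) // dvdn_exp2l //.
have : (0 < logn r M)%N by rewrite logn_gt0 mem_primes pr M0.
by move: (logn r M); clear; lia.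
Qed.

Lemma expz_eq1_modulus (Q : int) d : (Q ^+ d == 1 %[mod `|Q ^+ d - 1|%N])%Z.
Proof. by rewrite eqz_mod_dvd abszEsign dvdzE /= !abszM abszX abszN1 exp1n mul1n. Qed.

Lemma prim_root_unitr (R : unitRingType) M (z : R) : M.-primitive_root z -> z \is a GRing.unit.
Proof.
move=> pz; rewrite -(unitrX_pos _ (prim_order_gt0 pz)) (prim_expr_order pz).
exact: unitr1.
Qed.

(** The sum is close to x^(s-1) in absolute value, which exceeds s in all but the
smallest cases with x negative. *)
Lemma geometric_small (x : int) (s : nat) : (2 <= `|x|)%N -> (1 < s)%N ->
  (`|(\sum_(j < s) x ^+ j)%R| <= s)%N ->
  [\/ x = -2 /\ s = 2%N, x = -3 /\ s = 2%N | x = -2 /\ s = 3%N].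
Proof.
move=> x2 s2; set P := \sum_(j < s) _ => Ps.
have DP : (x - 1) * P = x ^+ s - 1 by rewrite subrX1.
have [x0|x0] := lerP 0 x.
  have [y Dx] : exists y : nat, x = y%:Z by exists `|x|%N; rewrite gez0_abs.
  have DPn : P = (\sum_(j < s) y ^ j)%N%:Z.
    by rewrite /P Dx -[RHS]natz natr_sum; apply: eq_bigr => i _; rewrite natrX natz.
  have : (s < \sum_(j < s) y ^ j)%N.
    case: s s2 {P Ps DP DPn} => [|[|s]] // _; rewrite Dx /= in x2.
    have A t : (t <= \sum_(j < t) y ^ j)%N.
      elim: t => [|t IH] //; rewrite big_ord_recr /= -addn1 leq_add //.
      by rewrite expn_gt0; lia.
    have B : (2 <= y ^ s.+1)%N.
      by rewrite expnS; have : (0 < y ^ s)%N by [rewrite expn_gt0; lia]; nia.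
    rewrite big_ord_recr /=; have := leq_add (A s.+1) B.
    by rewrite addnS addnS addn0.
  by move: Ps; rewrite DPn; lia.
have [y Dx] : exists y : nat, x = - y%:Z by exists `|x|%N; lia.
have y2 : (2 <= y)%N by lia.
have le : (y ^ s <= 1 + (y + 1) * s)%N.
  have h1 : `|(x ^+ s)%R|%N = (y ^ s)%N by rewrite abszX Dx abszN.
  have h2 : (`|((x - 1) * P)%R| <= (y + 1) * s)%N.
    by rewrite abszM leq_mul // Dx; lia.
  by rewrite DP in h2; lia.
case: (ltngtP s 3) => [s3|s3|s3].
- have {s2 s3} Ds : s = 2 by lia.
  rewrite Ds in le *; have [Dy|Dy] : y = 2%N \/ y = 3%N by nia.
    by constructor 1; rewrite Dx Dy.
  by constructor 2; rewrite Dx Dy.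
- have : (s.*2 * y <= y ^ s)%N.
    case: s s3 {s2 P Ps DP le} => // s s3; rewrite expnSr leq_mul2r; apply/orP; right.
    apply: leq_trans (_ : 2 ^ s <= _)%N; last by rewrite leq_exp2r //; lia.
    elim: s s3 => // s IH s3; have [->//|s4] : s = 2%N \/ (3 < s.+1)%N by lia.
    by rewrite expnS; have := IH s4; lia.
  by nia.
- rewrite s3 in le *; have : (y <= 2)%N by nia.
  move=> y2'; have Dy : y = 2%N by apply/eqP; rewrite eqn_leq y2' y2.
  by apply: Or33; rewrite Dx Dy.
Qed.

(** For (-3, 2) and (-2, 3) the period vanishes; (-2, 2) is the case where Q^d - 1 and Q - 1
have the same absolute value. *)
Definition exceptional (Q : int) (d : nat) :=
  [\/ Q = -2 /\ d = 2%N, Q = -3 /\ d = 2%N | Q = -2 /\ d = 3%N].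

(** Let e be the order of Q for the splitting moduli, d = e s and x = Q^e.  A prime l
dividing Psi = 1 + x + ... + x^(s-1) divides M, so it divides x - 1 and therefore
s; and l divides Psi only once, as x - 1 carries all factors l of M but one.
Hence Psi divides s, which leaves s = 1 or the exceptional cases. *)
Lemma powers_split (Q : int) d (M := `|Q ^+ d - 1|%N) : (2 <= `|Q|)%N -> (0 < d)%N ->
  exceptional Q d \/
  forall i, all (fun r => (Q ^+ i == 1 %[mod split_mod M r])%Z) (primes M) ->
     (Q ^+ i == 1 %[mod M])%Z.
Proof.
move=> Q2 d0.
have Qd1 : Q ^+ d - 1 != 0.
  rewrite subr_eq0; apply/eqP => /(congr1 absz); rewrite abszX absz1 => /eqP.
  by rewrite -(exp1n d) eqn_exp2r // => /eqP Q1; rewrite Q1 in Q2.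
have M0 : (0 < M)%N by rewrite absz_gt0.
have Md : (Q ^+ d == 1 %[mod M])%Z by apply: expz_eq1_modulus.
pose P i := all (fun r => (Q ^+ i == 1 %[mod split_mod M r])%Z) (primes M).
have PM i : (Q ^+ i == 1 %[mod M])%Z -> P i.
  move=> Pi; apply/allP => r /split_mod_dvd rM; move: Pi; rewrite !eqz_mod_dvd; apply: dvdz_trans.
  by rewrite dvdzE.
have exP : exists e, (0 < e)%N && P e by exists d; rewrite d0 PM.
case: (ex_minnP exP) => e /andP[e0 Pe] emin.
have Pmul t : P (e * t)%N.
  apply/allP => r rM; rewrite exprM -modzXm (eqP (allP Pe r rM)) modzXm expr1n //.
have Pdvd i : P i -> (e %| i)%N.
  move=> Pi; apply: contraT; rewrite /dvdn -lt0n => r0.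
  have : (e <= i %% e)%N.
    apply: emin; rewrite r0 /=; apply/allP => r rM; move: (allP Pi r rM).
    rewrite {1}(divn_eq i e) exprD mulnC -modzMml (eqP (allP (Pmul (i %/ e)%N) r rM)).
    by rewrite modzMml mul1r.
  by rewrite leqNgt ltn_pmod.
have /dvdnP[s Ds] := Pdvd d (PM d Md).
have s0 : (0 < s)%N by case: (s) Ds d0 => // ->.
have [s1|s1] : s = 1%N \/ (1 < s)%N by lia.
  right=> i /Pdvd/dvdnP[t ->]; rewrite mulnC exprM; have -> : e = d by rewrite Ds s1 mul1n.
  by rewrite -modzXm (eqP Md) modzXm expr1n.
left; set x := Q ^+ e.
have x2 : (2 <= `|x|)%N.
  by rewrite abszX (leq_trans Q2) // -{1}[`|Q|%N]expn1 leq_pexp2l //; lia.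
set Psi := \sum_(j < s) x ^+ j.
have DM : M = (`|x - 1| * `|Psi|)%N.
  by rewrite -abszM -subrX1 /x -exprM mulnC -Ds.
have Psi0 : (0 < `|Psi|)%N by move: M0; rewrite DM muln_gt0 => /andP[].
have x10 : (0 < `|x - 1|)%N by move: M0; rewrite DM muln_gt0 => /andP[].
have Psi_s : (`|Psi| %| s)%N.
  apply/dvdn_partP => // l; rewrite mem_primes => /and3P[pl _ lPsi].
  have lM : l \in primes M by rewrite mem_primes pl M0 DM dvdn_mull.
  have bx : (split_mod M l %| `|x - 1|)%N.
    by move: (allP Pe l lM); rewrite eqz_mod_dvd dvdzE.
  have lb : (l ^ 1 %| split_mod M l)%N by rewrite dvdn_exp2l // leq_maxl.
  have lx : (x = 1 %[mod l])%Z.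
    by apply/eqP; rewrite eqz_mod_dvd dvdzE /= (dvdn_trans _ bx) // -{1}[l]expn1.
  have ls : (l %| s)%N.
    have : (Psi == s%:Z %[mod l])%Z.
      rewrite /Psi; elim: (s) => [|t IH]; first by rewrite big_ord0.
      rewrite big_ord_recr /= -modzDm (eqP IH) -[in X in (_ + X)%Z]modzXm lx modzXm expr1n modzDm.
      by rewrite -addn1 PoszD.
    rewrite eqz_mod_dvd => h; have : (l %| Psi - (Psi - s%:Z))%Z by rewrite rpredB // dvdzE.
    by rewrite opprB addrC subrK dvdzE.
  rewrite p_part -[X in (_ %| X)%N]muln1 dvdn_mulr //.
  have v1 : (logn l `|Psi| <= 1)%N.
    have h1 : logn l M = (logn l `|x - 1| + logn l `|Psi|)%N by rewrite DM lognM.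
    have h2 : (maxn 1 (logn l M).-1 <= logn l `|x - 1|)%N by rewrite -pfactor_dvdn.
    move: h1 h2; move: (logn l M) (logn l `|x - 1|) (logn l `|Psi|); clear; lia.
  by rewrite (dvdn_trans _ ls) // -[X in (_ %| X)%N]expn1 dvdn_exp2l.
have ex3 := geometric_small x2 s1 (dvdn_leq s0 Psi_s).
have e1 : e = 1%N.
  have: (`|x| <= 3)%N by case: ex3 => [][-> _].
  rewrite /x abszX; case: (e) e0 => [|[|m]] // _ h.
  have : (2 ^ m.+2 <= 3)%N by apply: leq_trans h; rewrite leq_exp2r.
  by rewrite !expnS; have : (0 < 2 ^ m)%N by [rewrite expn_gt0]; lia.
by move: ex3; rewrite /x Ds e1 expr1 muln1.
Qed.

Lemma exprz_eqmod (R : unitRingType) (z : R) M (a b : int) : z \is a GRing.unit ->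
  z ^+ M = 1 -> (a == b %[mod M])%Z -> z ^ a = z ^ b.
Proof.
move=> uz zM; rewrite eqz_mod_dvd => /dvdzP[t E].
have -> : a = t * M + b by rewrite -E subrK.
by rewrite exprzDr // [t * M]mulrC -exprz_exp -exprnP zM exp1rz mul1r.
Qed.

Lemma modulus_signed (eps : int) q d : eps = 1 \/ eps = -1 ->
  `|q%:Z ^+ d - eps ^+ d|%N = `|(eps * q) ^+ d - 1|%N.
Proof.
move=> he; have e2 : eps ^+ d * eps ^+ d = 1.
  by rewrite -exprMn; case: he => ->; rewrite ?mulrNN mulr1 expr1n.
have -> : (eps * q) ^+ d - 1 = eps ^+ d * (q%:Z ^+ d - eps ^+ d) by rewrite exprMn mulrBr e2.
rewrite abszM; have -> : `|eps ^+ d|%N = 1%N; last by rewrite mul1n.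
by case: he => ->; rewrite abszX ?abszN exp1n.
Qed.

Lemma powers_stab (Q : int) d (M := `|Q ^+ d - 1|%N) (z : algC) k :
   (2 <= `|Q|)%N -> (0 < d)%N -> M.-primitive_root z -> coprime k M ->
  \sum_(i < d) z ^ (Q ^+ i) = \sum_(i < d) z ^ (k%:Z * Q ^+ i) ->
  exceptional Q d \/ exists j, (k%:Z == Q ^+ j %[mod M])%Z.
Proof.
move=> Q2 d0 pz ck S; have [|spl] := powers_split Q2 d0; [by left | right].
have M0 := prim_order_gt0 pz.
have Md : (Q ^+ d == 1 %[mod M])%Z by apply: expz_eq1_modulus.
have [a Da] : exists a : nat, (a%:Z = Q %[mod M])%Z.
  by exists `|(Q %% M)%Z|%N; rewrite gez0_abs ?modz_ge0 ?modz_mod //; lia.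
have aX m i : (m %| M)%N -> (((a ^ i)%N)%:Z == Q ^+ i %[mod m])%Z.
  move=> mM; have am : (a%:Z == Q %[mod m])%Z.
    by move/eqP: Da; rewrite !eqz_mod_dvd; apply: dvdz_trans; rewrite dvdzE.
  by rewrite -natz natrX natz -modzXm (eqP am) modzXm.
have aX1 m i : (m %| M)%N -> (a ^ i == 1 %[mod m])%N = (Q ^+ i == 1 %[mod m])%Z.
  by move=> mM; rewrite -(eqP (aX m i mM)) !modz_nat eqz_nat.
have ad : a ^ d = 1 %[mod M] by apply/eqP; rewrite aX1.
have ca : coprime a M.
  by rewrite -(coprime_pexpl _ _ d0) -coprime_modl ad coprime_modl coprime1n.
have zu := prim_root_unitr pz.
have zM := prim_expr_order pz.
have [||j E] := @period_stab M z pz a k d d0 ca ck ad; last first.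
- by exists j; rewrite -(eqP (aX M j _)) // !modz_nat E.
- transitivity (\sum_(i < d) z ^ (Q ^+ i)).
    by apply: eq_bigr => i _; rewrite exprnP; apply: (exprz_eqmod zu zM); rewrite aX.
  rewrite S; apply: eq_bigr => i _; rewrite [RHS]exprnP; apply: (exprz_eqmod zu zM).
  by rewrite PoszM -[in X in (_ == X)%Z]modzMmr (eqP (aX M i _)) // modzMmr.
move=> i si; apply/eqP; rewrite aX1 //; apply: spl; apply/allP => r rM.
by rewrite -aX1 ?(allP si) // split_mod_dvd.
Qed.

(** In the exceptional cases k = 1 modulo |Q - 1|, which the first period gives, is
already equivalent to being a power of Q modulo |Q^d - 1|. *)
Lemma periods_stab (Q : int) n k (z : nat -> algC) : (2 <= `|Q|)%N ->
  (forall d, (1 <= d <= n)%N -> [/\ `|(Q ^+ d - 1)%R|.-primitive_root (z d),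
     coprime k `|Q ^+ d - 1| &
     \sum_(i < d) z d ^ (Q ^+ i) = \sum_(i < d) z d ^ (k%:Z * Q ^+ i)]) ->
  forall d, (1 <= d <= n)%N -> exists j, (k%:Z == Q ^+ j %[mod `|Q ^+ d - 1|%N])%Z.
Proof.
move=> Q2 hyp d dn; have [pz ck S] := hyp d dn; have /andP[d0 dln] := dn.
have [ex|//] := powers_stab Q2 d0 pz ck S.
have n1 : (1 <= 1 <= n)%N by rewrite (leq_trans d0 dln).
have [pz1 ck1] := hyp 1%N n1.
rewrite !big_ord1 !expr0 mulr1 -!exprnP => /eqP.
rewrite eq_sym (eq_prim_root_expr pz1) => k1.
case: ex => [][Qe de]; subst Q d; move: k1 {S pz pz1 ck1 hyp}; rewrite /= => k1.
- by exists 0%N; rewrite expr0 modz_nat.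
- have [] : k = 1 %[mod 8] \/ k = 5 %[mod 8] by move/eqP: k1 => /=; lia.
    by exists 0%N; rewrite modz_nat; apply/eqP; congr Posz.
  by exists 1%N; rewrite modz_nat; apply/eqP; congr Posz.
have [|[]] : k = 1 %[mod 9] \/ k = 4 %[mod 9] \/ k = 7 %[mod 9] by move/eqP: k1 => /=; lia.
- by exists 0%N; rewrite modz_nat; apply/eqP; congr Posz.
- by exists 2%N; rewrite modz_nat; apply/eqP; congr Posz.
- by exists 1%N; rewrite modz_nat; apply/eqP; congr Posz.
Qed.

(** * Similarity of matrices from ranks *)

Section Similarity.
Variables (F : finFieldType) (n' : nat).
Local Notation n := n'.+1.
Implicit Types (A B U W : 'M[F]_n) (p h f : {poly F}) (v : 'rV[F]_n).

Lemma irreducible_factor p : (1 < size p)%N ->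
  exists2 f, irreducible_poly f & f %| p.
Proof.
move: {2}(size p) (leqnn (size p)) => s; elim: s p => [|s IH] p ps p1; first by lia.
have [/existsP[/= u /andP[/andP[u1 us] up]]|/existsPn no] :=
  boolP [exists u : 'rV_(size p), (1 < size (rVpoly u) < size p)%N && (rVpoly u %| p)].
  have [|f fi fu] := IH (rVpoly u) _ u1; first by rewrite -ltnS (leq_trans us ps).
  by exists f => //; apply: dvdp_trans up.
exists p => //; split=> // q q1 qp.
have p0 : p != 0 by rewrite -size_poly_gt0; lia.
have qs := dvdp_leq p0 qp.
have := no (poly_rV q); rewrite poly_rV_K // qp andbT negb_and -!leqNgt.
rewrite -dvdp_size_eqp // eqn_leq qs.
have : size q != 0%N by rewrite size_poly_eq0; apply: contraNneq p0 => q0; rewrite -dvd0p -q0.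
by case: (size q) q1 => [|[|k]].
Qed.

Lemma irreducible_split f p : irreducible_poly f -> p != 0 ->
  exists m q, p = f ^+ m * q /\ coprimep f q.
Proof.
move=> fi; move: {2}(size p) (leqnn (size p)) => s; elim: s p => [|s IH] p ps p0.
  by move: p0; rewrite -size_poly_gt0; lia.
have [/dvdpP[q Dp]|] := boolP (f %| p); last first.
  by rewrite -irreducible_poly_coprime // => cf; exists 0%N, p; rewrite expr0 mul1r.
have q0 : q != 0 by apply: contraNneq p0 => q0; rewrite Dp q0 mul0r.
have f0 : f != 0 by apply: irredp_neq0.
have [||m [q' [Dq cf]]] := IH q => //; last first.
  by exists m.+1, q'; split=> //; rewrite Dp Dq exprS mulrC mulrA.
have := ps; rewrite Dp size_mul //.
by case: fi => f1 _; move: f1; move: (size f) (size q) => a b; lia.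
Qed.

(** Not required to be monic, so h is determined up to a constant. *)
Definition annihilator_poly A m (U : 'M[F]_(m, n)) h :=
  h != 0 /\ forall p, (U *m horner_mx A p == 0) = (h %| p).

(** Killing U is a linear condition on the coefficients of a polynomial, so the least
degree of a nonzero solution is found by testing the freeness of a matrix. *)
Lemma annih_exists A m (U : 'M_(m, n)) : exists h, annihilator_poly A U h.
Proof.
pose M d := powers_mx A d *m lin_mulmx U.
have ME d (u : 'rV_d) : u *m M d = mxvec (U *m horner_mx A (rVpoly u)).
  by rewrite mulmxA -[u *m _]vec_mxK -horner_rVpoly mul_vec_lin.
have MP d : reflect (exists p, [/\ p != 0, (size p <= d)%N & U *m horner_mx A p = 0])
                    (~~ row_free (M d)).
  rewrite -kermx_eq0; apply: (iffP idP) => [/rowV0Pn[u /sub_kermxP uM u0]|[p [p0 ps Up]]].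
    exists (rVpoly u); split; [|exact: size_poly|]; last by apply: (can_inj mxvecK);
      rewrite -ME uM linear0.
      by apply: contraNneq u0 => u0; rewrite -[u]rVpolyK u0 linear0.
  apply/rowV0Pn; exists (poly_rV p).
    by apply/sub_kermxP; rewrite ME poly_rV_K // Up linear0.
  by apply: contraNneq p0 => p0; rewrite -(poly_rV_K ps) p0 linear0.
have ex : exists d, ~~ row_free (M d).
  exists (size (mxminpoly A)); apply/MP; exists (mxminpoly A); split=> //.
    exact/monic_neq0/mxminpoly_monic.
  by rewrite mx_root_minpoly mulmx0.
case: (ex_minnP ex) => d /MP[h [h0 hd Uh]] dmin.
exists h; split=> // p; apply/eqP/idP => [Up|/dvdpP[q ->]]; last first.
  by rewrite mulrC rmorphM /= mulmxA Uh mul0mx.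
apply: contraT; rewrite -[h %| p]/(p %% h == 0) => r0.
have : (d <= size (p %% h)%R)%N.
  apply: dmin; apply/MP; exists (p %% h); split=> //.
  have := Up;
    rewrite {1}(divp_eq p h) rmorphD rmorphM mulmxDr /= -[horner_mx A _ * _]comm_horner_mx2.
  by rewrite mulmxA Uh mul0mx add0r.
by rewrite leqNgt (leq_trans (ltn_modpN0 p h0) hd).
Qed.

Lemma horner_mxM A p q : horner_mx A (p * q) = horner_mx A p *m horner_mx A q.
Proof. exact: rmorphM. Qed.

Lemma mulmx_hornerM A m (U : 'M[F]_(m, n)) p q :
  U *m horner_mx A (p * q) = U *m horner_mx A p *m horner_mx A q.
Proof. by rewrite horner_mxM mulmxA. Qed.

Lemma stablemx_horner A m1 m2 (V : 'M_(m1, n)) (U : 'M_(m2, n)) p :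
  (V <= U)%MS -> (U *m A <= U)%MS -> (V *m horner_mx A p <= U)%MS.
Proof.
move=> VU UA; apply: submx_trans (submxMr _ VU) _ => {V VU}.
elim/poly_ind: p => [|p c IHp]; first by rewrite rmorph0 mulmx0 sub0mx.
rewrite rmorphD rmorphM /= horner_mx_X horner_mx_C mulmxDr mul_mx_scalar.
rewrite addmx_sub ?scalemx_sub // mulmxA; apply: submx_trans UA; exact: submxMr.
Qed.

Lemma annih_sub A m1 m2 (U : 'M_(m1, n)) (V : 'M_(m2, n)) h p :
  annihilator_poly A U h -> (V <= U)%MS -> h %| p -> V *m horner_mx A p = 0.
Proof.
move=> [_ hU] /submxP[X ->]; rewrite -hU => /eqP Up.
by rewrite -mulmxA Up mulmx0.
Qed.


Lemma annih_horner A m (U : 'M_(m, n)) f g : f * g != 0 ->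
  annihilator_poly A U (f * g) -> annihilator_poly A (U *m horner_mx A f) g.
Proof.
rewrite mulf_eq0 negb_or => /andP[f0 g0] [_ hU]; split=> // p.
by rewrite -mulmx_hornerM hU dvdp_mul2l.
Qed.

(** Some vector has the same annihilator as the whole stable space.  If h = f^m g with
f irreducible and prime to g, take v1 in U g(A) not killed by f^(m-1) and, by
induction, v2 in U f^m(A) with annihilator g: then v1 + v2 has annihilator f^m g. *)
Lemma annih_vector A m (U : 'M_(m, n)) h :
  annihilator_poly A U h -> (U *m A <= U)%MS -> exists2 v : 'rV_n, (v <= U)%MS & annihilator_poly A v h.
Proof.
move: {2}(size h) (leqnn (size h)) => s; elim: s m U h => [|s IH] m U h hs [h0 hU] UA.
  by move: h0; rewrite -size_poly_gt0 ltnNge hs.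
have [h1|h1] := leqP (size h) 1.
  exists 0; first exact: sub0mx; split=> // p; rewrite mul0mx eqxx; apply/esym.
  have /size_poly1P[c c0 ->] : size h == 1%N by rewrite eqn_leq h1 size_poly_gt0.
  by rewrite -[c%:P]mulr1 mul_polyC dvdpZl // dvd1p.
have [f fi fh] := irreducible_factor h1.
have [m0 [g [Dh cfg]]] := irreducible_split fi h0.
have m_gt0 : (0 < m0)%N.
  case: m0 Dh => // Dh; move: cfg fh; rewrite Dh expr0 mul1r.
  by rewrite irreducible_poly_coprime // => /negP.
case: m0 m_gt0 Dh => // e _ Dh.
have f0 : f != 0 := irredp_neq0 fi.
have fe0 j : f ^+ j != 0 by rewrite expf_eq0 (negPf f0) andbF.
have g0 : g != 0 by apply: contraNneq h0 => g0; rewrite Dh g0 mulr0.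
have cfeg j : coprimep (f ^+ j) g by rewrite coprimep_expl.
have [v1 v1U [v1f v1m]] : exists2 v1 : 'rV_n, (v1 <= U)%MS & 
    v1 *m horner_mx A (f ^+ e.+1) = 0 /\ v1 *m horner_mx A (f ^+ e) != 0.
  have : U *m horner_mx A (g * f ^+ e) != 0.
    rewrite hU Dh mulrC dvdp_mul2l // exprS -[X in _ %| X]mul1r dvdp_mul2r //.
    by rewrite dvdp1; case: fi => f1 _; rewrite neq_ltn f1 orbT.
  move/eqP => ne; have /existsP[i Hi] : [exists i, row i (U *m horner_mx A (g * f ^+ e)) != 0].
    apply: contraT; rewrite negb_exists => /forallP z; case: ne.
    by apply/row_matrixP => i; move/negPn/eqP: (z i) ->; rewrite row0.
  exists (row i U *m horner_mx A g).
    rewrite -row_mul; apply: submx_trans (row_sub _ _) _.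
    exact: stablemx_horner.
  split; last by rewrite -mulmx_hornerM -row_mul.
  rewrite -mulmx_hornerM -row_mul.
  by have := hU (g * f ^+ e.+1); rewrite mulrC -Dh dvdpp => /eqP ->; rewrite row0.
have v1P p : v1 *m horner_mx A p = 0 -> f ^+ e.+1 %| p.
  move=> vp; have [->|p0] := eqVneq p 0; first exact: dvdp0.
  have [j [q [Dp cfq]]] := irreducible_split fi p0.
  rewrite Dp; case: (leqP e.+1 j) => [ej|je]; first by rewrite dvdp_mulr // dvdp_exp2l.
  case/eqP: v1m.
  have /Bezout_eq1_coprimepP[[a b] /= ab] : coprimep (f ^+ e.+1) q by rewrite coprimep_expl.
  have -> : f ^+ e = (a * f ^+ e) * f ^+ e.+1 + (b * f ^+ (e - j)) * p.
    have fe : f ^+ e = f ^+ (e - j) * f ^+ j by rewrite -exprD subnK.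
    rewrite -[LHS]mulr1 -ab Dp mulrDr; congr (_ + _); first by ring.
    by rewrite {1}fe; ring.
  rewrite rmorphD /= mulmxDr ![_ * f ^+ e.+1]mulrC ![_ * p]mulrC !mulmx_hornerM v1f vp.
  by rewrite !mul0mx addr0.
have [|||v2 v2U [_ v2P]] := IH _ (U *m horner_mx A (f ^+ e.+1)) g.
- rewrite -ltnS; apply: leq_trans hs; rewrite Dh size_mul //.
  have : (1 < size (f ^+ e.+1))%N.
    rewrite -[f ^+ _]mulr1; case: fi => f1 _.
    by rewrite mulr1 -subn_gt0 subn1 size_exp muln_gt0 -subn1 subn_gt0 f1.
  by move: (size (f ^+ _)) (size g) => a b; lia.
- by apply: annih_horner; rewrite -Dh.
- by rewrite -{2}[A]horner_mx_X -mulmx_hornerM mulrC mulmx_hornerM submxMr // horner_mx_X.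
exists (v1 + v2).
  rewrite addmx_sub //; apply: submx_trans v2U _; exact: stablemx_horner.
split=> // p; apply/eqP/idP => [vp|hp]; last first.
  apply: (@annih_sub _ _ _ U _ h) => //.
  rewrite addmx_sub //; apply: submx_trans v2U _; exact: stablemx_horner.
have v2g : v2 *m horner_mx A g = 0 by apply/eqP; rewrite v2P.
rewrite Dh Gauss_dvdp //; apply/andP; split.
  rewrite -(Gauss_dvdpl _ (cfeg _)) ; apply: v1P.
  have := congr1 (mulmx^~ (horner_mx A g)) vp.
  by rewrite mul0mx !mulmxDl -!mulmx_hornerM [X in _ + _ *m horner_mx A X]mulrC (mulmx_hornerM _ v2) v2g mul0mx addr0.
rewrite -(Gauss_dvdpl _ (_ : coprimep g (f ^+ e.+1))) 1?coprimep_sym // -v2P.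
have := congr1 (mulmx^~ (horner_mx A (f ^+ e.+1))) vp.
rewrite mul0mx !mulmxDl -!mulmx_hornerM mulrC (mulmx_hornerM _ v1) v1f mul0mx add0r.
by move/eqP.
Qed.


Lemma horner_mx_Xn A i : horner_mx A 'X^i = A ^+ i.
Proof. by rewrite rmorphXn /= horner_mx_X. Qed.

Definition krylov A v d : 'M[F]_(d, n) := \matrix_(i < d) (v *m A ^+ i).

Lemma mul_krylov A v d (u : 'rV_d) :
  u *m krylov A v d = v *m horner_mx A (rVpoly u).
Proof.
rewrite mulmx_sum_row /rVpoly poly_def rmorph_sum mulmx_sumr.
apply: eq_bigr => i _; rewrite rowK (valK i) /= horner_mxZ -scalemxAr.
by rewrite rmorphXn /= horner_mx_X.
Qed.

(** Multiplication by p modulo h, acting on polynomials of degree less than d, which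
is meant to be the degree of h. *)
Definition modmul_mx p h d : 'M[F]_d := \matrix_(i < d) poly_rV (('X^i * p) %% h).

Section Cyclic.
Variables (A : 'M[F]_n) (v : 'rV[F]_n) (h : {poly F}).
Hypothesis vh : annihilator_poly A v h.
Let D := (size h).-1.

(** In the basis v, vA, ..., the action of A on a cyclic space depends only on the
annihilator: this makes cyclic spaces with the same annihilator isomorphic. *)
Lemma krylov_horner p : krylov A v D *m horner_mx A p = modmul_mx p h D *m krylov A v D.
Proof.
have [h0 hP] := vh; apply/row_matrixP => i; rewrite !row_mul !rowK mul_krylov poly_rV_K;
  last first.
  by rewrite -ltnS prednK ?size_poly_gt0 ?ltn_modpN0.
rewrite -horner_mx_Xn -mulmx_hornerM.
apply/eqP; rewrite -subr_eq0 -mulmxBr -rmorphB hP /=.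
by rewrite {1}(divp_eq ('X^i * p) h) addrK dvdp_mull.
Qed.

Lemma krylov_free : row_free (krylov A v D).
Proof.
have [h0 hP] := vh.
rewrite -kermx_eq0; apply/rowV0P => u /sub_kermxP /eqP; rewrite mul_krylov hP => hu.
rewrite -[u]rVpolyK; have -> : rVpoly u = 0; last by rewrite linear0.
apply: contraTeq hu => u0; apply/negP => /(dvdp_leq u0).
by rewrite leqNgt -(prednK (_ : 0 < size h)%N) ?size_poly_gt0 // ltnS size_poly.
Qed.

Lemma krylov_sub m (U : 'M_(m, n)) : (v <= U)%MS -> (U *m A <= U)%MS ->
  (krylov A v D <= U)%MS.
Proof.
move=> vU UA; apply/row_subP => i; rewrite rowK -horner_mx_Xn.
exact: stablemx_horner.
Qed.

(** Choose a linear form c that vanishes on v, vA, ..., v A^(D-2) and not on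
v A^(D-1).  The complement is the largest stable subspace of U on which c vanishes:
as h kills U it is cut out by the D forms A^j c, and it meets the cyclic space
trivially because c does not vanish on v p(A) A^j for j = D - 1 - deg p. *)
Lemma krylov_complement U : (U *m A <= U)%MS -> (v <= U)%MS -> annihilator_poly A U h ->
  exists W, [/\ (W *m A <= W)%MS, (krylov A v D + W :=: U)%MS
              & (krylov A v D :&: W)%MS = 0].
Proof.
move=> UA vU Uh; have [h0 hP] := vh.
set Z := krylov A v D.
have D1 : size h = D.+1 by rewrite prednK // size_poly_gt0.
have /row_freeP[B ZB] := krylov_free.
pose c : 'cV_n := B *m \col_(i < D) (i.+1 == D)%:R.
have Zc (u : 'rV_D) : u *m Z *m c = (\sum_i u 0 i * (i.+1 == D)%:R)%:M.
  rewrite -mulmxA [Z *m _]mulmxA ZB mul1mx; apply/matrixP=> i j.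
  by rewrite !ord1 !mxE eqxx mulr1n; apply: eq_bigr => k _; rewrite mxE.
pose Y : 'M_(n, D) := \matrix_(i, j) (A ^+ j *m c) i 0.
have colY j : col j Y = A ^+ j *m c.
  by apply/matrixP=> i k; rewrite ord1 !mxE.
have YP m (X : 'M_(m, n)) : X *m Y = 0 <-> forall j : 'I_D, X *m (A ^+ j *m c) = 0.
  split=> [XY j|XY]; first by rewrite -colY colE mulmxA XY mul0mx.
  by apply/matrixP=> i j; have := XY j; rewrite -colY colE mulmxA -colE => /matrixP/(_ i 0);
    rewrite !mxE.
exists (U :&: kermx Y)%MS.
have WA : ((U :&: kermx Y)%MS *m A <= U :&: kermx Y)%MS.
  have WU := capmxSl U (kermx Y).
  have /YP WY : (U :&: kermx Y)%MS *m Y = 0 by apply/sub_kermxP/capmxSr.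
  set W := (U :&: kermx Y)%MS in WU WY *.
  rewrite sub_capmx (submx_trans (submxMr _ WU) UA); apply/sub_kermxP/YP => j.
  rewrite mulmxA -[W *m A *m _]mulmxA -[A *m _]exprS.
  have [jD|jD] := ltnP j.+1 D; first by rewrite -mulmxA; exact: (WY (Ordinal jD)).
  have {jD}-> : j.+1 = D by have := ltn_ord j; lia.
  have := annih_sub Uh WU (dvdpp h).
  rewrite -{1}[h]coefK poly_def D1 big_ord_recr rmorphD rmorph_sum /= mulmxDr mulmx_sumr.
  move/(congr1 (mulmx^~ c)); rewrite mul0mx mulmxDl mulmx_suml big1 ?add0r => [|i _].
    rewrite horner_mxZ -scalemxAr -scalemxAl rmorphXn /= horner_mx_X => /eqP.
    have -> : h`_D = lead_coef h by [].
    by rewrite scalemx_eq0 lead_coef_eq0 (negPf h0) => /eqP.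
  by rewrite horner_mxZ -scalemxAr -scalemxAl rmorphXn /= horner_mx_X -mulmxA WY scaler0.
have ZW0 : (Z :&: (U :&: kermx Y))%MS = 0.
  apply/eqP/rowV0P => x; rewrite sub_capmx => /andP[/submxP[u Du]].
  rewrite sub_capmx => /andP[_ /sub_kermxP/YP xY].
  have [u0|u0] := eqVneq (rVpoly u) 0; first by rewrite Du -[u]rVpolyK u0 linear0 mul0mx.
  have su : (size (rVpoly u) <= D)%N := size_poly _ _.
  have su0 : (0 < size (rVpoly u))%N by rewrite size_poly_gt0.
  have jD : (D - size (rVpoly u) < D)%N by lia.
  exfalso; have := xY (Ordinal jD); rewrite /= Du mulmxA mul_krylov -horner_mx_Xn -mulmx_hornerM.
  have sX : (size (rVpoly u * 'X^(D - size (rVpoly u)))%R <= D)%N.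
    by rewrite size_mulXn // subnK.
  rewrite -(poly_rV_K sX) -mul_krylov -/Z Zc => /matrixP/(_ 0 0); rewrite !mxE mulr1n.
  have D0 : (0 < D)%N by lia.
  have lD : (D.-1 < D)%N by lia.
  rewrite (bigD1 (Ordinal lD)) //= prednK // eqxx mulr1 big1 ?addr0 => [|i ni]; last first.
    by case: eqP => [iD|_]; rewrite ?mulr0 //; case/eqP: ni; apply: val_inj => /=; lia.
  rewrite mxE coefMXn; case: ltnP => [lt|_].
    by exfalso; move: lt su su0 D0 => /=; move: (size (rVpoly u)) => a; clear; lia.
  rewrite /=; have -> : (D.-1 - (D - size (rVpoly u)) = (size (rVpoly u)).-1)%N by move: su su0;
    move: (size (rVpoly u)) => a; clear; lia.
  by move/eqP; rewrite -[_`_ _]/(lead_coef _) lead_coef_eq0 (negPf u0).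
have Zsub : (Z + (U :&: kermx Y) <= U)%MS by rewrite addsmx_sub capmxSl krylov_sub.
split=> //.
apply/eqmxP; rewrite Zsub -(geq_leqif (mxrank_leqif_sup Zsub)).
rewrite mxrank_disjoint_sum // (eqnP krylov_free) -(mxrank_mul_ker U Y).
by rewrite leq_add2r rank_leq_col.
Qed.
End Cyclic.

(** Both spaces have the same annihilator h, read off from the ranks that vanish.
Vectors of annihilator h span isomorphic cyclic spaces, and their complements
still have equal ranks, so that induction applies. *)
Lemma stable_rank_similar A B U W :
  (U *m A <= U)%MS -> (W *m B <= W)%MS ->
  (forall p, \rank (U *m horner_mx A p) = \rank (W *m horner_mx B p)) ->
  exists2 T, U *m A *m T = U *m T *m B & (U *m T :=: W)%MS.
Proof.
move: {2}(\rank U) (leqnn (\rank U)) => s; elim: s U W => [|s IH] U W.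
  rewrite leqn0 mxrank_eq0 => /eqP -> _ _ /(_ 1).
  rewrite !rmorph1 !mulmx1 mxrank0 => /esym/eqP; rewrite mxrank_eq0 => /eqP ->.
  by exists 0; rewrite !(mul0mx, mulmx0).
move=> rU UA WB rUW.
have [U0|U0] := eqVneq U 0.
  by apply: IH => //; rewrite U0 mxrank0.
have [h Uh] := annih_exists A U.
have Wh : annihilator_poly B W h.
  by case: Uh => h0 hP; split=> // p; rewrite -hP -!mxrank_eq0 rUW.
have [v vU vh] := annih_vector Uh UA.
have [w wW wh] := annih_vector Wh WB.
set D := (size h).-1.
have [U' [U'A UE U'0]] := krylov_complement vh UA vU Uh.
have [W' [W'B WE W'0]] := krylov_complement wh WB wW Wh.
set Zv := krylov A v _ in UE U'0; set Zw := krylov B w _ in WE W'0.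
have rk A0 U0' v0 U1 p : annihilator_poly A0 v0 h -> (U1 *m A0 <= U1)%MS ->
    (krylov A0 v0 D + U1 :=: U0')%MS -> (krylov A0 v0 D :&: U1)%MS = 0 ->
    \rank (U0' *m horner_mx A0 p) = (\rank (modmul_mx p h D) + \rank (U1 *m horner_mx A0 p))%N.
  move=> vh0 U1A E0 C0.
  rewrite -(eqmxMr _ E0) addsmxMr krylov_horner // mxrank_disjoint_sum.
    by rewrite (mxrankMfree _ (krylov_free vh0)).
  apply/eqP; rewrite -submx0 -C0 capmxS ?submxMl //; exact: stablemx_horner.
have rU' p : \rank (U' *m horner_mx A p) = \rank (W' *m horner_mx B p).
  by have := rUW p;
    rewrite (rk _ _ _ _ _ _ vh U'A UE U'0) (rk _ _ _ _ _ _ wh W'B WE W'0) => /addnI.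
have D0 : (0 < D)%N.
  case: vh => h0 hP; rewrite /D; case E: (size h) => [|[|k]] //=.
    by move/eqP: E; rewrite size_poly_eq0 (negPf h0).
  case: Uh => _ /(_ 1); rewrite rmorph1 mulmx1 (negPf U0).
  by rewrite dvdp1 E.
have ltU : (\rank U' <= s)%N.
  move: rU; rewrite -UE mxrank_disjoint_sum // (eqnP (krylov_free vh)) -/D.
  by move: (\rank U') => r; lia.
have [T' AT' WT'] := IH U' W' ltU U'A W'B rU'.
have ZvV : exists X, Zv *m X = 1%:M by apply/row_freeP/(krylov_free vh).
have {ZvV}[X ZX] := ZvV.
pose V := <<Zv>>%MS.
have VU0 : (V :&: U')%MS = 0 by apply/eqP; rewrite -submx0 -U'0 capmxS ?genmxE.
have UV0 : (U' :&: V)%MS = 0 by rewrite capmxC.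
have [T [ZT UT]] : exists T, Zv *m T = Zw /\
    forall m (Y : 'M_(m, n)), (Y <= U')%MS -> Y *m T = Y *m T'.
  exists (proj_mx V U' *m (X *m Zw) + proj_mx U' V *m T').
  have ZV : (Zv <= V)%MS by rewrite genmxE.
  have [PV PU] := (proj_mx_id VU0 ZV, proj_mx_0 UV0 ZV).
  split=> [|m Y YU].
    rewrite mulmxDr [Zv *m (proj_mx V _ *m _)]mulmxA [Zv *m (proj_mx U' _ *m _)]mulmxA.
    by rewrite PV PU mulmxA ZX mul1mx mul0mx addr0.
  rewrite mulmxDr [Y *m (proj_mx V _ *m _)]mulmxA [Y *m (proj_mx U' _ *m _)]mulmxA.
  by rewrite (proj_mx_0 VU0 YU) (proj_mx_id UV0 YU) !mul0mx add0r.
exists T; last first.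
  apply: eqmx_trans WE; apply: eqmx_trans (eqmxMr T (eqmx_sym UE)) _.
  apply: eqmx_trans (addsmxMr _ _ _) _; rewrite ZT UT //.
  exact: adds_eqmx.
have : (U <= Zv + U')%MS by rewrite UE.
case/sub_addsmxP => [[x y] /= ->].
rewrite !mulmxDl -!mulmxA; congr (x *m _ + y *m _); rewrite !mulmxA.
  rewrite ZT -[A](horner_mx_X A) krylov_horner // -mulmxA ZT.
  by rewrite -[in RHS](horner_mx_X B) krylov_horner.
by rewrite !UT.
Qed.

Lemma rank_similar A B :
  (forall p, \rank (horner_mx A p) = \rank (horner_mx B p)) ->
  exists2 T, T \in unitmx & A *m T = T *m B.
Proof.
move=> rAB; have [||p|T] := @stable_rank_similar A B 1%:M 1%:M; rewrite ?submx1 //.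
  by rewrite !mul1mx.
rewrite !mul1mx => AT T1; exists T => //.
by rewrite -row_full_unit /row_full; rewrite T1 mxrank1.
Qed.

Lemma rank_kermxpoly A p : \rank (horner_mx A p) = (n - \rank (kermxpoly A p))%N.
Proof. by rewrite mxrank_ker subKn ?rank_leq_row. Qed.

Lemma rank_kermxpolyM A p q : coprimep p q ->
  \rank (kermxpoly A (p * q)) = (\rank (kermxpoly A p) + \rank (kermxpoly A q))%N.
Proof. by move=> c; rewrite (kermxpolyM _ c) mxrank_disjoint_sum ?mxdirect_kermxpoly. Qed.

(** The kernel of p(A) is the direct sum of the kernels of the f^m(A), for the primary
factors f^m of p. *)
Lemma primary_rank A B :
  (forall f m, irreducible_poly f ->
     \rank (horner_mx A (f ^+ m)) = \rank (horner_mx B (f ^+ m))) ->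
  forall p, \rank (horner_mx A p) = \rank (horner_mx B p).
Proof.
move=> rf p; rewrite !rank_kermxpoly; congr (_ - _)%N.
move: {2}(size p) (leqnn (size p)) => s; elim: s p => [|s IH] p ps.
  have/eqP -> : p == 0 by rewrite -size_poly_leq0.
  by rewrite /kermxpoly !rmorph0.
have [p1|p1] := leqP (size p) 1.
  by rewrite [p]size1_polyC // /kermxpoly !horner_mx_C.
have p0 : p != 0 by rewrite -size_poly_gt0 ltnW.
have [f fi fp] := irreducible_factor p1.
have [m [q [Dp cfq]]] := irreducible_split fi p0.
have m0 : (0 < m)%N.
  case: m Dp => // Dp; move: fp; rewrite Dp expr0 mul1r => fp.
  by move: cfq; rewrite irreducible_poly_coprime // fp.
have q0 : q != 0 by apply: contraNneq p0 => q0; rewrite Dp q0 mulr0.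
have fm0 : f ^+ m != 0 by rewrite expf_eq0 (negPf (irredp_neq0 fi)) andbF.
have cfmq : coprimep (f ^+ m) q by rewrite coprimep_expl.
rewrite Dp (rank_kermxpolyM A cfmq) (rank_kermxpolyM B cfmq); congr (_ + _)%N; last first.
  apply: IH; rewrite -ltnS; apply: leq_trans ps; rewrite Dp size_mul //.
  have : (1 < size (f ^+ m))%N.
    by case: fi => f1 _; rewrite -subn_gt0 subn1 size_exp muln_gt0 m0 -subn1 subn_gt0 f1.
  by move: (size (f ^+ _)) (size q) => a b; lia.
have := rf f m fi; rewrite !rank_kermxpoly => /(congr1 (subn n)).
by rewrite !subKn ?rank_leq_row.
Qed.

Lemma primary_rank_similar A B :
  (forall f m, irreducible_poly f ->
     \rank (horner_mx A (f ^+ m)) = \rank (horner_mx B (f ^+ m))) ->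
  exists2 T, T \in unitmx & A *m T = T *m B.
Proof. by move=> rf; apply/rank_similar/primary_rank. Qed.

End Similarity.

(** * Units of finite rings with involution *)

Section FiniteRing.
Variable R : finUnitRingType.
Implicit Types x y z c d : R.

Definition central d := forall x, d * x = x * d.

Lemma lreg_unit x : (forall y, x * y = 0 -> y = 0) -> x \is a GRing.unit.
Proof.
move=> xreg; have xinj : injective ( *%R x).
  by move=> y z /eqP; rewrite -subr_eq0 -mulrBr => /eqP/xreg/eqP; rewrite subr_eq0 => /eqP.
pose y := invF xinj 1; have xy : x * y = 1 by rewrite (f_invF xinj).
apply/unitrP; exists y; split=> //; apply: (xinj); rewrite mulrA xy mul1r mulr1 //.
Qed.

Lemma power_period z : exists i per, (0 < per)%N /\ z ^+ (i + per) = z ^+ i.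
Proof.
pose h (i : 'I_#|R|.+1) := z ^+ i.
have /injectivePn[i [j ij hij]] : ~~ injectiveb h.
  by apply/negP => /injectiveP/leq_card; rewrite card_ord ltnn.
wlog lij : i j ij hij / (i < j)%N.
  move=> W; case: (ltngtP i j) => [|/W|/val_inj ji]; [exact: W| |by rewrite ji eqxx in ij].
  by rewrite eq_sym; apply.
exists i, (j - i)%N; rewrite subn_gt0 lij subnKC ?(ltnW lij) //.
Qed.

Lemma unit_period c : c \is a GRing.unit -> exists2 N, (0 < N)%N & c ^+ N = 1.
Proof.
move=> uc; have [i [per [p0 E]]] := power_period c; exists per => //.
by apply: (mulrI (unitrX i uc)); rewrite -exprD E mulr1.
Qed.

Lemma idempotent_power c z : c \is a GRing.unit ->
  exists N, [/\ (0 < N)%N, c ^+ N = 1 & z ^+ N * z ^+ N = z ^+ N].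
Proof.
move=> /unit_period[o o0 co]; have [i [per [p0 E]]] := power_period z.
have per_t t m : (i <= m)%N -> z ^+ (m + per * t) = z ^+ m.
  move=> im; elim: t => [|t IH]; first by rewrite muln0 addn0.
  rewrite -[RHS]IH mulnS;
    have -> : (m + (per + per * t) = (m - i + per * t) + (i + per))%N by lia.
  by rewrite exprD E -exprD; congr (_ ^+ _); lia.
exists (per * (i.+1 * o))%N; split; first by rewrite !muln_gt0 p0 o0.
  by rewrite mulnA mulnC exprM co expr1n.
by rewrite -exprD per_t //; nia.
Qed.

(** This is the existence of t with t + c t' invertible in Hilbert's Theorem 90.  For an
involution ' such that c c' = 1 and d' is the image of d, the power e of 1 + c is
fixed by ', because c^N = 1, so t = e + (1 - e) d has image e + (1 - e) d'.  As e is
idempotent, 1 + c is invertible on the image of e, where t = t' = 1; it is nilpotent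
on the image of 1 - e, where t + c t' = (d - d') + (1 + c) d' differs from a unit by
a nilpotent. *)
Lemma hilbert90_unit c : c \is a GRing.unit -> exists N,
  c ^+ N = 1 /\ forall d d', central d -> central d' -> d - d' \is a GRing.unit ->
   let e := (1 + c) ^+ N in (e + (1 - e) * d) + c * (e + (1 - e) * d') \is a GRing.unit.
Proof.
move=> uc; pose z := 1 + c; have [N [N0 cN zN]] := idempotent_power z uc.
exists N; split=> // d d' dC d'C ud; rewrite -/z; set e := z ^+ N => {uc cN} /=.
have ez : e * z = z * e by rewrite -exprSr exprS.
have ee : e * e = e := zN.
have ec : e * c = c * e.
  by have := ez; rewrite mulrDr mulrDl mulr1 mul1r => /addrI.
have fc : (1 - e) * c = c * (1 - e) by rewrite mulrBl mulrBr mul1r mulr1 ec.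
have ef : e * (1 - e) = 0 by rewrite mulrBr mulr1 ee subrr.
have ff : (1 - e) * (1 - e) = 1 - e by rewrite mulrBl mul1r ef subr0.
have fe : (1 - e) * e = 0 by rewrite mulrBl mul1r ee subrr.
apply: lreg_unit => y Wy.
have ey : e * y = 0.
  have eW : e * (e + (1 - e) * d + c * (e + (1 - e) * d')) = e * z.
    rewrite [LHS]mulrDr [X in X + _]mulrDr [e * ((1 - e) * d)]mulrA ef mul0r addr0 ee.
    rewrite [e * (c * _)]mulrA ec -mulrA [e * (_ + _)]mulrDr ee [e * ((1 - e) * d')]mulrA ef mul0r addr0.
    by rewrite /z [RHS]mulrDr mulr1 ec.
  have : e * z * y = 0 by rewrite -eW -mulrA Wy mulr0.
  rewrite ez -mulrA => zey.
  by rewrite -ee -mulrA {1}/e -(prednK N0) exprSr -mulrA zey mulr0.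
have fy : (1 - e) * y = y by rewrite mulrBl mul1r ey subr0.
have dy : (d + c * d') * y = 0.
  rewrite -fy mulrA.
  have -> : (d + c * d') * (1 - e) = (1 - e) * (e + (1 - e) * d + c * (e + (1 - e) * d')).
    rewrite [RHS]mulrDr [X in _ = X + _]mulrDr [(1 - e) * ((1 - e) * d)]mulrA ff fe add0r.
    rewrite [(1 - e) * (c * _)]mulrA fc -mulrA [(1 - e) * (e + _)]mulrDr fe add0r.
    by rewrite [(1 - e) * ((1 - e) * d')]mulrA ff mulrDl -mulrA (dC (1 - e)) (d'C (1 - e)).
  by rewrite -mulrA Wy mulr0.
have {}dy : (d - d') * y = - d' * (z * y).
  apply/eqP; rewrite -subr_eq0 -[X in _ == X]dy /z; apply/eqP.
  by rewrite mulNr opprK mulrBl [(1 + c) * y]mulrDl mul1r [d' * (_ + _)]mulrDr addrA subrK mulrA d'C -mulrDl.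
have kC : central ((d - d')^-1 * - d').
  move=> x; have bC : (d - d') * x = x * (d - d') by rewrite mulrBl mulrBr dC d'C.
  have bVC : (d - d')^-1 * x = x * (d - d')^-1.
    by apply: (mulrI ud); rewrite !mulrA mulrV // mul1r bC -mulrA mulrV // mulr1.
  by rewrite !mulrN !mulNr -mulrA d'C !mulrA bVC.
have {}dy : y = ((d - d')^-1 * - d') * (z * y) by rewrite -mulrA -dy mulKr.
set k := _ * _ in kC dy.
have it m : y = k ^+ m * (z ^+ m * y).
  elim: m => [|m IH]; first by rewrite !expr0 !mul1r.
  rewrite {1}dy {1}IH exprS exprS -!mulrA; congr (_ * (_ * _)).
  have kX : central (k ^+ m) by move=> x; apply: commr_sym; apply: commrX; exact/commr_sym/kC.
  by rewrite !mulrA; congr (_ * _); rewrite kX.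
by rewrite (it N) -/e ey mulr0.
Qed.

End FiniteRing.

Section Involution.
(* st is an anti-automorphism of order two, and dl a central element that it moves
   by a unit, as a scalar outside the fixed field does for the conjugate transpose. *)
Variables (R : finUnitRingType) (st : {additive R -> R}) (dl : R).
Hypotheses (stM : forall x y, st (x * y) = st y * st x) (stK : involutive st)
  (dlC : central dl) (sdlC : central (st dl)) (udl : dl - st dl \is a GRing.unit).
Implicit Types (u v a g h : {unit R}).
Local Notation uv := (@FinRing.uval R).

Lemma st1 : st 1 = 1.
Proof. by rewrite -[LHS]mulr1 -{2}[1]stK -stM mulr1 stK. Qed.

Lemma stX x N : st (x ^+ N) = st x ^+ N.
Proof. by elim: N => [|N IH]; rewrite ?st1 // exprS stM IH exprSr. Qed.

Lemma st_unit x : x \is a GRing.unit -> st x \is a GRing.unit.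
Proof.
move=> ux; apply/unitrP; exists (st x^-1).
by rewrite -!stM mulrV // mulVr // st1.
Qed.

Lemma stV x : x \is a GRing.unit -> st x^-1 = (st x)^-1.
Proof. by move=> ux; apply: (mulrI (st_unit ux)); rewrite -stM mulVr // st1 mulrV // st_unit. Qed.

Definition gst u : {unit R} := FinRing.Unit (st_unit (valP u)).

Lemma gstM u v : gst (u * v)%g = (gst v * gst u)%g.
Proof. by apply: val_inj; rewrite /= stM. Qed.
Lemma gstK : involutive gst.
Proof. by move=> u; apply: val_inj; rewrite /= stK. Qed.
Lemma gstV u : gst u^-1%g = ((gst u)^-1)%g.
Proof. by apply: val_inj; rewrite /= stV // (valP u). Qed.

(** Let H be the double centralizer of a, an abelian group stable under the involution.
By Hilbert's Theorem 90 the kernel of the norm y |-> y * gst y on H is the image of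
y |-> y * (gst y)^-1, whose kernel is the group of Hermitian elements of H.
Comparing orders, the norm maps H onto its Hermitian elements. *)
Lemma hermitian_norm a : gst a = a ->
  exists2 y, y \in 'C('C[a])%g & (y * gst y)%g = a.
Proof.
move=> ha; set H := 'C('C[a])%g.
have aH : a \in H by apply/centP => b /cent1P; apply: commute_sym.
have Ha y : y \in H -> y \in 'C[a]%g.
  by move=> /centP yH; apply/cent1P; apply: yH; rewrite cent1id.
have cHH x y : x \in H -> y \in H -> commute x y.
  by move=> /centP xH /Ha yH; apply: xH.
have gH y : y \in H -> gst y \in H.
  move=> /centP yH; apply/centP => b ba.
  have: commute y (gst b).
    apply: yH; apply/cent1P; rewrite /commute -{1}ha -{2}ha -!gstM; congr gst.
    by have /cent1P := ba.
  by move/(congr1 gst); rewrite !gstM gstK => E; rewrite /commute E.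
pose nm x := (x * gst x)%g.
pose dm x := (x * (gst x)^-1)%g.
have nmM : {in H &, {morph nm : x y / (x * y)%g}}.
  move=> x y xH yH; rewrite /nm gstM (cHH (gst y)) ?gH // -!mulgA; congr (_ * _)%g.
  by rewrite !mulgA (cHH y (gst x)) ?gH.
have dmM : {in H &, {morph dm : x y / (x * y)%g}}.
  move=> x y xH yH; rewrite /dm gstM invMg -!mulgA; congr (_ * _)%g.
  by rewrite !mulgA; congr (_ * _)%g; rewrite (cHH y) ?groupV ?gH.
pose fn := Morphism nmM; pose fd := Morphism dmM.
have kerD x : (x \in 'ker fd)%g = (x \in H) && (gst x == x).
  apply/idP/andP => [xk|[xH /eqP gx]].
    split; first exact: (dom_ker xk).
    by have /mker := xk; rewrite /= /dm => /eqP; rewrite -eq_mulgV1 eq_sym.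
  by apply/kerP => //=; rewrite /dm gx mulgV.
have kerN : ('ker fn \subset fd @* H)%g.
  apply/subsetP => c ck; have cH := dom_ker ck; have /= := mker ck; rewrite /nm => cc.
  have [N [cN /(_ dl (st dl) dlC sdlC udl)]] := hilbert90_unit (valP c).
  cbv zeta; set e := (1 + _) ^+ N; set W := (X in X \is a _) => uW.
  have cst : uv c * st (uv c) = 1 by have := congr1 val cc.
  have stc : st (uv c) * uv c = 1.
    by apply: (mulrI (valP c)); rewrite mulrA cst mul1r mulr1.
  have se : st e = e.
    rewrite /e stX raddfD st1 /= -[LHS]mul1r -{1}cN -exprMn_comm; last first.
      by rewrite /GRing.comm mulrDl mulrDr cst stc mul1r mulr1.
    by rewrite mulrDr mulr1 cst addrC.
  have sf : st (1 - e) = 1 - e by rewrite raddfB st1 /= se.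
  have comm_e b : GRing.comm b (uv c) -> GRing.comm b e.
    by move=> bc; apply/commrX/commrD => //; apply: commr1.
  have ec : uv c * e = e * uv c by apply: comm_e.
  have comm_f b : GRing.comm b e -> GRing.comm b (1 - e).
    by move=> be; apply: commrB => //; apply: commr1.
  have fc : uv c * (1 - e) = (1 - e) * uv c by apply: comm_f.
  have sW : uv c * st W = W.
    have s1 : st (e + (1 - e) * dl) = e + st dl * (1 - e) by rewrite raddfD /= stM se sf.
    have s2 : st (uv c * (e + (1 - e) * st dl)) = (e + dl * (1 - e)) * st (uv c).
      by rewrite stM raddfD /= stM stK se sf.
    rewrite /W raddfD /= s1 s2.
    rewrite mulrDr addrC; congr (_ + _); last by rewrite sdlC.
    rewrite mulrA mulrDr ec [uv c * (dl * _)]mulrA -(dlC (uv c)) -[dl * _ * _]mulrA fc.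
    by rewrite mulrA -mulrDl -mulrA cst mulr1 dlC.
  pose w := FinRing.Unit uW.
  have wH : w \in H.
    apply/centP => b /cent1P ba.
    have bc : GRing.comm (uv b) (uv c).
      by have /centP/(_ b) := cH; rewrite cent1E => /(_ (introT eqP ba))/(congr1 val).
    have be := comm_e _ bc; have bf := comm_f _ be.
    apply/val_inj/esym; rewrite /= -[_ * _]/(_ * _).
    apply: commrD; first by apply: commrD => //; apply: commrM => //; apply/commr_sym/dlC.
    apply: commrM => //; apply: commrD => //; apply: commrM => //; apply/commr_sym/sdlC.
  apply/morphimP; exists w => //=; rewrite /dm.
  by apply: (mulIg (gst w)); rewrite mulgKV; apply: val_inj; rewrite /= sW.
have imN : (fn @* H \subset 'ker fd)%g.
  apply/subsetP => _ /morphimP[x xH _ ->] /=; rewrite kerD /nm groupM ?gH //=.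
  by rewrite gstM gstK.
have eN : (fn @* H)%g = ('ker fd)%g.
  apply/eqP; rewrite eqEcard imN /=.
  have cn := card_morphim fn 'C('C[a])%G; have cd := card_morphim fd 'C('C[a])%G.
  rewrite !setIid in cn cd.
  have sn : ('ker fn)%g \subset 'C('C[a])%G by apply: subsetIl.
  have sd : ('ker fd)%g \subset 'C('C[a])%G by apply: subsetIl.
  have := Lagrange sd; rewrite -(Lagrange sn) -cn -cd => E.
  have kd := subset_leq_card kerN.
  rewrite -(leq_pmul2r (cardG_gt0 (fd @* 'C('C[a])%G)%G)) E mulnC.
  by rewrite leq_mul2l kd orbT.
have : a \in (fn @* H)%g by rewrite eN kerD aH ha eqxx.
by case/morphimP => y yH _ ->; exists y.
Qed.

(** From x g x^-1 = h, both unitary, a = gst x * x commutes with g.  Writing a as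
gst z * z with z in the double centralizer of a, hence commuting with g, the
element x * z^-1 is unitary and still conjugates g to h. *)
Lemma unitary_conj g h x : (g * gst g = 1)%g -> (h * gst h = 1)%g -> (x * g = h * x)%g ->
  exists2 u, (u * gst u = 1)%g & (u * g = h * u)%g.
Proof.
move=> /(canRL (mulKg _)); rewrite mulg1 => gE /(canRL (mulKg _)); rewrite mulg1 => hE xg.
have xh : (gst x * h = g * gst x)%g.
  have := congr1 gst xg; rewrite !gstM gE hE => E.
  by rewrite -[LHS](mulKVg g) [X in (_ * X)%g]mulgA E mulgKV.
have ha : gst (gst x * x)%g = (gst x * x)%g by rewrite gstM gstK.
have [y yC yE] := hermitian_norm ha.
have yg : commute y g.
  by move/centP: yC; apply; apply/cent1P; rewrite /commute -mulgA xg !mulgA xh.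
have y'g : commute (gst y) g.
  have := congr1 gst yg; rewrite !gstM gE => E.
  by rewrite -[g]invgK; apply: commuteV; rewrite /commute E.
have uu : (gst (x * (gst y)^-1) * (x * (gst y)^-1) = 1)%g.
  by rewrite gstM gstV gstK -!mulgA [(gst x * _)%g]mulgA -yE -mulgA mulgV mulg1 mulVg.
exists (x * (gst y)^-1)%g; first by rewrite -[X in (X * _)%g](mulg1_eq uu) mulVg.
by rewrite -mulgA -(commuteV (commute_sym y'g)) !mulgA xg.
Qed.

(** The hypothesis says that x satisfies b x (gst b) = x, so the solutions of this
equation are the x t with t in the centralizer of gst b.  Hilbert's Theorem 90 for
c = x^-1 * gst x provides a Hermitian invertible one; it is y * gst y, and
conjugation by y turns b into a unitary element. *)
Lemma unitary_form b x : (x * (gst b)^-1 = b * x)%g ->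
  exists y, let g := (y^-1 * b * y)%g in (g * gst g = 1)%g.
Proof.
move=> xb; have bxb : (b * x * gst b = x)%g by rewrite -xb mulgKV.
have bsxb : (b * gst x * gst b = gst x)%g.
  by have := congr1 gst bxb; rewrite !gstM gstK mulgA.
pose c := (x^-1 * gst x)%g.
have cb : commute c (gst b).
  apply: (mulgI (b * x)%g); rewrite [LHS]mulgA [RHS]mulgA bxb /c mulKVg.
  by rewrite [(_ * (_ * gst x))%g]mulgA mulgK bsxb.
have [N [cN /(_ dl (st dl) dlC sdlC udl)]] := hilbert90_unit (valP c).
cbv zeta; set e := (1 + _) ^+ N; set W := (X in X \is a _) => uW.
pose w := FinRing.Unit uW.
have stc : st (uv c) * st (uv x) = st (uv x) * uv c^-1%g.
  have : (gst c * gst x = gst x * c^-1)%g by rewrite /c gstM gstV gstK invMg invgK mulgA mulgV mul1g mulgKV.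
  by move/(congr1 uv).
have cV1 : (1 + uv c^-1%g) ^+ N = e.
  rewrite /e -[LHS]mul1r -{1}cN -exprMn_comm; last first.
    by rewrite /GRing.comm mulrDl mulrDr mul1r mulr1 /= divrr ?mulVr // (valP c).
  by rewrite mulrDr mulr1 /= divrr ?(valP c) // addrC.
have ste : st e * st (uv x) = st (uv x) * e.
  have step : (1 + st (uv c)) * st (uv x) = st (uv x) * (1 + uv c^-1%g).
    by rewrite mulrDl mulrDr mul1r mulr1 stc.
  rewrite -[in RHS]cV1 /e stX raddfD st1 /=.
  elim: (N) => [|m IH]; first by rewrite !expr0 mul1r mulr1.
  by rewrite exprSr -mulrA step mulrA IH -mulrA -exprSr.
have stf : st (1 - e) * st (uv x) = st (uv x) * (1 - e).
  by rewrite raddfB st1 mulrBl mulrBr mul1r mulr1 /= ste.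
pose t := e + (1 - e) * dl; pose t' := e + (1 - e) * st dl.
have tx : st t * st (uv x) = st (uv x) * t'.
  by rewrite /t /t' raddfD /= stM mulrDl ste -mulrA stf [RHS]mulrDr; congr (_ + _);
    rewrite sdlC -mulrA.
have t'x : st t' * uv x = uv x * t.
  by have := congr1 st tx; rewrite !stM !stK => <-.
have DS : uv (x * w)%g = uv x * t + st (uv x) * t'.
  by rewrite /= /W [LHS]mulrDr [uv x * (_ * _)]mulrA /= mulrA divrr ?mul1r // (valP x).
have hS : gst (x * w)%g = (x * w)%g.
  by apply: val_inj; change (st (uv (x * w)%g) = uv (x * w)%g);
    rewrite DS raddfD /= !stM !stK tx t'x addrC.
have wb : commute w (gst b).
  have bc : GRing.comm (uv (gst b)) (uv c) by have := congr1 uv cb.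
  have be : GRing.comm (uv (gst b)) e by apply/commrX/commrD => //; apply: commr1.
  have bf : GRing.comm (uv (gst b)) (1 - e) by apply: commrB => //; apply: commr1.
  apply/val_inj/esym; rewrite /= -[_ * _]/(_ * _).
  apply: commrD; first by apply: commrD => //; apply: commrM => //; apply/commr_sym/dlC.
  apply: commrM => //; apply: commrD => //; apply: commrM => //; apply/commr_sym/sdlC.
have bS : (b * (x * w) * gst b = x * w)%g by rewrite -!mulgA wb !mulgA bxb.
have [y _ yS] := hermitian_norm hS.
exists y => /=.
transitivity (y^-1 * (b * (y * gst y) * gst b) * (gst y)^-1)%g;
  first by rewrite !gstM gstV !mulgA.
by rewrite yS bS -yS mulKg mulgV.
Qed.
End Involution.

(** * Powers of matrices in GL and GU *)

Lemma frobenius_power_morphism (R : comNzRingType) p e : p \in [pchar R] ->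
  {s : {rmorphism R -> R} | forall x, s x = x ^+ (p ^ e)}.
Proof.
move=> ch; elim: e => [|e [s sE]].
  by exists (idfun : {rmorphism R -> R}) => x; rewrite expn0 expr1.
exists ((pFrobenius_aut ch : {rmorphism R -> R}) \o s) => x /=.
by rewrite sE pFrobenius_autE -exprM expnSr.
Qed.

(** The values x^(Q^i), for i <= n, are n + 1 roots of P, so two of them coincide. *)
Lemma orbit_period (L : fieldType) (P : {poly L}) (n : nat) (Q : int) (x : L) :
  (size P <= n.+1)%N -> P != 0 ->
  (forall y : L, y != 0 -> root P y -> root P (y ^ Q)) ->
  (forall y z : L, y ^ Q = z ^ Q -> y = z) ->
  x != 0 -> root P x ->
  exists2 d, (1 <= d <= n)%N & x ^ (Q ^+ d) = x.
Proof.
move=> sP P0 cl inj x0 rx.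
have inX i (y z : L) : y ^ (Q ^+ i) = z ^ (Q ^+ i) -> y = z.
  elim: i y z => [|i IH] y z; first by rewrite !expr0.
  by rewrite !exprS -!exprz_exp => /IH/inj.
have xi i : x ^ (Q ^+ i) != 0 /\ root P (x ^ (Q ^+ i)).
  elim: i => [|i [IH1 IH2]]; first by rewrite expr0.
  by rewrite exprSr -exprz_exp expfz_neq0 // cl.
pose h (i : 'I_n.+1) := x ^ (Q ^+ i).
have /injectivePn[i [j ij hij]] : ~~ injectiveb h.
  apply/negP => /injectiveP hinj.
  have := @max_poly_roots _ P (map h (enum 'I_n.+1)) P0.
  rewrite size_map size_enum_ord (map_inj_uniq hinj) enum_uniq ltnNge sP => H.
  suff: false by []; apply: H => //; apply/allP => _ /mapP[i _ ->].
  by case: (xi i).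
wlog lij : i j ij hij / (i < j)%N.
  move=> W; case: (ltngtP i j) => [|ji|/val_inj ji]; [exact: W| |by rewrite ji eqxx in ij].
  by apply: (W j i) => //; rewrite eq_sym.
exists (j - i)%N; first by have := ltn_ord j; lia.
apply: (inX i); rewrite exprz_exp -exprD subnK ?(ltnW lij) //.
Qed.

Lemma irreducible_dvd_of_root (F : fieldType) (L : fieldType) (iota : {rmorphism F -> L})
  (f g : {poly F}) (x : L) : irreducible_poly f ->
  root (map_poly iota f) x -> root (map_poly iota g) x -> f %| g.
Proof.
move=> fi fx gx; apply: contraT; rewrite -irreducible_poly_coprime // => cfg.
have : coprimep (map_poly iota f) (map_poly iota g) by rewrite coprimep_map.
by move/coprimep_root => /(_ _ fx); rewrite (eqP gx) eqxx.
Qed.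

Lemma eigenvalue_trmx (K : fieldType) m (g : 'M[K]_m) x : eigenvalue g^T x = eigenvalue g x.
Proof.
rewrite !eigenvalue_root_char; congr (root _ _).
rewrite /char_poly -det_tr; congr (\det _); apply/matrixP => i j.
by rewrite !mxE eq_sym.
Qed.
Section MatrixPowers.
Variables (F : finFieldType) (n' : nat).
Local Notation n := n'.+1.
Implicit Types (g : 'M[F]_n) (f p : {poly F}).

Lemma horner_mx_comp_Xn g p k : horner_mx g (p \Po 'X^k) = horner_mx (g ^+ k) p.
Proof.
elim/poly_ind: p => [|p c IH]; first by rewrite comp_poly0 !rmorph0.
rewrite comp_polyD comp_polyM comp_polyX comp_polyC !rmorphD !rmorphM /= IH.
by rewrite !horner_mx_C horner_mx_X rmorphXn /= horner_mx_X.
Qed.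

Lemma rank_horner_dvd g f p : f %| p -> (\rank (horner_mx g p) <= \rank (horner_mx g f))%N.
Proof. by case/dvdpP => r ->; rewrite horner_mxM mxrankM_maxr. Qed.

Lemma rank_horner_coprime g f m : coprimep f (char_poly g) ->
  \rank (horner_mx g (f ^+ m)) = n.
Proof.
move=> cf; have /Bezout_eq1_coprimepP[[a b] /= ab] : coprimep (f ^+ m) (char_poly g).
  by rewrite coprimep_expl.
apply/eqP; rewrite -[_ == _]/(row_free _) row_free_unit.
have := congr1 (horner_mx g) ab.
rewrite rmorphD rmorph1 /= !horner_mxM Cayley_Hamilton mulmx0 addr0.
by case/mulmx1_unit.
Qed.

End MatrixPowers.

Section PowerSimilarity.
Variables (p e q : nat) (eps : int) (F : finFieldType) (n' : nat) (s : {rmorphism F -> F}).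
Local Notation n := n'.+1.
Hypotheses (pF : p \in [pchar F]) (hq : q = (p ^ e)%N) (q_gt0 : (0 < q)%N).
Hypotheses (heps : eps = 1 \/ eps = -1) (sE : forall x, s x = x ^+ q).
Hypotheses (s1 : eps = 1 -> s =1 id) (sN : eps = -1 -> involutive s).
Implicit Types (g h : 'M[F]_n) (f P : {poly F}).
Local Notation Q := (eps * q%:Z).

Definition star g := (map_mx s g)^T.

(** No condition when eps = 1, so that GL and GU are treated together. *)
Definition eps_unitary g := eps = -1 -> g *m star g = 1%:M.

Section Extension.
Variables (L : fieldType) (iota : {rmorphism F -> L}).

Lemma frobenius_ext : {sL : {rmorphism L -> L} | (forall x, sL x = x ^+ q) /\
   forall P, map_poly sL (map_poly iota P) = map_poly iota (map_poly s P)}.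
Proof.
have pL : p \in [pchar L] by rewrite (fmorph_pchar iota).
have [sL sLE] := frobenius_power_morphism e pL.
exists sL; split=> [x|P]; first by rewrite sLE hq.
rewrite -!map_poly_comp; apply: eq_map_poly => x /=.
by rewrite sLE sE rmorphXn hq.
Qed.

Lemma eigenvalue_unit_neq0 g x : g \in unitmx -> eigenvalue (map_mx iota g) x -> x != 0.
Proof.
move=> ug /eigenvalueP[v vg v0]; apply: contraNneq v0 => x0; move: vg; rewrite x0 scale0r.
have ug' : map_mx iota g \in unitmx by rewrite map_unitmx.
by move/(congr1 (mulmx^~ (invmx (map_mx iota g)))); rewrite mulmxK // mul0mx => ->.
Qed.

(** When eps = 1 this is the Frobenius map on the roots of the characteristic polynomial.
When eps = -1, x^q is an eigenvalue of star g, which is the inverse of g. *)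
Lemma eigenvalue_twist g x : g \in unitmx -> eps_unitary g ->
  eigenvalue (map_mx iota g) x -> eigenvalue (map_mx iota g) (x ^ Q).
Proof.
move=> ug hg gx; have [sL [sLE sLm]] := frobenius_ext.
have sgx : eigenvalue (map_mx iota (map_mx s g)) (sL x).
  move: gx; rewrite !eigenvalue_root_char -!map_char_poly -sLm => gx.
  by rewrite fmorph_root.
case: heps => [e1|e1].
  have -> : x ^ Q = sL x by rewrite e1 mul1r sLE.
  have <- : map_mx s g = g by apply/matrixP => i j; rewrite mxE s1.
  by [].
have gg : map_mx iota g *m map_mx iota (star g) = 1%:M by rewrite -map_mxM hg // map_mx1.
rewrite -eigenvalue_trmx map_trmx in sgx.
have /eigenvalueP[v vg v0] := sgx.
have sx0 : sL x != 0 by rewrite fmorph_eq0 (eigenvalue_unit_neq0 ug gx).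
apply/eigenvalueP; exists v => //.
have -> : x ^ Q = (sL x)^-1 by rewrite e1 mulN1r -exprnN sLE.
have gg' : map_mx iota (star g) *m map_mx iota g = 1%:M by apply: mulmx1C.
have /(congr1 (mulmx^~ (map_mx iota g))) := vg.
rewrite -mulmxA [X in _ *m X]gg' mulmx1 -scalemxAl => E.
by rewrite {2}E scalerA mulVf // scale1r.
Qed.

Lemma power_inj (y z : L) : y ^ Q = z ^ Q -> y = z.
Proof.
have [sL [sLE _]] := frobenius_ext.
case: heps => ->; rewrite ?mul1r ?mulN1r.
  by rewrite -!exprnP -!sLE => /fmorph_inj.
rewrite -!exprnN => /invr_inj; rewrite -!sLE; exact: fmorph_inj.
Qed.

(** The orbit of x under x |-> x^Q has some length d <= n, so x^M_d = 1 and only k modulo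
M_d matters. *)
Lemma eigenvalue_power g k x : g \in unitmx -> eps_unitary g ->
  (forall d, (1 <= d <= n)%N -> exists j, (k%:Z == Q ^+ j %[mod `|Q ^+ d - 1|%N])%Z) ->
  eigenvalue (map_mx iota g) x -> exists j, x ^+ k = x ^ (Q ^+ j).
Proof.
move=> ug hg hk gx; have x0 := eigenvalue_unit_neq0 ug gx.
have [||||||d dn xd] := @orbit_period L (char_poly (map_mx iota g)) n Q x.
- by rewrite size_char_poly.
- exact/monic_neq0/char_poly_monic.
- by move=> y y0; rewrite -!eigenvalue_root_char; apply: eigenvalue_twist.
- exact: power_inj.
- by [].
- by rewrite -eigenvalue_root_char.
have [j kj] := hk d dn; exists j; rewrite exprnP.
apply: exprz_eqmod kj; first by rewrite unitfE.
have x1 : x ^ (Q ^+ d - 1) = 1.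
  by rewrite exprzDr ?unitfE // xd exprN1 mulfV.
case: (Q ^+ d - 1) x1 => m /=; first by [].
by rewrite NegzE -exprnN => /eqP; rewrite invr_eq1 => /eqP.
Qed.
End Extension.

Lemma horner_mx_star g P : horner_mx (star g) (map_poly s P) = star (horner_mx g P).
Proof.
rewrite /star map_horner_mx.
elim/poly_ind: (map_poly s P) => [|r c IH]; first by rewrite !rmorph0 trmx0.
rewrite !rmorphD !rmorphM /= !horner_mx_C !horner_mx_X linearD /= tr_scalar_mx.
rewrite trmx_mul IH -[_ * _]/(_ *m _); congr (_ + _).
rewrite -{2}[(map_mx s g)^T]horner_mx_X -IH -horner_mxM mulrC.
by rewrite horner_mxM horner_mx_X.
Qed.

Lemma star_exp g i : star (g ^+ i) = star g ^+ i.
Proof.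
elim: i => [|i IH]; first by rewrite !expr0 /star map_mx1 trmx1.
by rewrite exprSr exprS -IH /star map_mxM trmx_mul.
Qed.

Lemma rank_star g : \rank (star g) = \rank g.
Proof. by rewrite mxrank_tr mxrank_map. Qed.

(** Let x be a root of f that is an eigenvalue of g.  If x^k = x^(q^j) is a conjugate of x
over F, then f divides f(X^k) and the inequality follows.  When eps = -1 and j is
odd, x^-k is a root of the image f' of f under the Frobenius map s, so f divides
f'(X^(-k)); and f'(g^-k) = f'(star (g^k)) has the rank of f(g^k). *)
Lemma rank_power_le g k N f m : (0 < N)%N -> g ^+ N = 1 -> eps_unitary g ->
  (forall d, (1 <= d <= n)%N -> exists j, (k%:Z == Q ^+ j %[mod `|Q ^+ d - 1|%N])%Z) ->
  irreducible_poly f ->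
  (\rank (horner_mx (g ^+ k) (f ^+ m)) <= \rank (horner_mx g (f ^+ m)))%N.
Proof.
move=> N0 gN hg hk fi.
have ug : g \in unitmx.
  by case: N N0 gN => // N _; rewrite exprS => /mulmx1_unit[].
have [cf|] := boolP (coprimep f (char_poly g));
  first by rewrite (rank_horner_coprime m cf) rank_leq_row.
rewrite irreducible_poly_coprime // negbK => fchi.
have [L _ [x fx _]] := irredp_FAdjoin fi.
pose iota : {rmorphism F -> L} := in_alg L.
have gx : eigenvalue (map_mx iota g) x.
  rewrite eigenvalue_root_char -map_char_poly; have /dvdpP[r ->] := fchi.
  by rewrite rmorphM rootM fx orbT.
have [j xk] := eigenvalue_power ug hg hk gx.
have [sL [sLE sLm]] := frobenius_ext iota.
have xq i : x ^+ (q ^ i) = iter i sL x.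
  by elim: i => [|i IH]; rewrite ?expn0 ?expr1 //= -IH sLE -exprM expnSr.
have rt i : root (map_poly iota (iter i (map_poly s) f)) (x ^+ (q ^ i)).
  by rewrite xq; elim: i => //= i IH; rewrite -sLm fmorph_root.
have rk P k1 : root (map_poly iota P) (x ^+ k1) ->
    (\rank (horner_mx (g ^+ k1) (P ^+ m)) <= \rank (horner_mx g (f ^+ m)))%N.
  move=> Px; rewrite -horner_mx_comp_Xn; apply: rank_horner_dvd.
  rewrite rmorphXn dvdp_exp2r //; apply: irreducible_dvd_of_root fi fx _.
  rewrite map_comp_poly root_comp map_polyXn hornerXn //.
have it2 i : eps = -1 -> iter i.*2 (map_poly s) f = f.
  move=> e1; elim: i => //= i ->; rewrite -map_poly_comp map_poly_id // => y _ /=; exact: sN.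
have QE : (Q ^+ j = eps ^+ j * (q ^ j)%N%:Z)%R.
  by rewrite exprMn; congr (_ * _); rewrite -[RHS]natz natrX natz.
have [xkq|[e1 [jo xkq]]] : (x ^+ k = x ^+ (q ^ j)%N /\ iter j (map_poly s) f = f) \/
    (eps = -1 /\ odd j /\ x ^+ k = (x ^+ (q ^ j)%N)^-1).
- case: heps => e1.
    left; split; first by rewrite xk QE e1 expr1n mul1r.
    by elim: (j) => //= i ->; rewrite map_poly_id // => y _; rewrite s1.
  have [jo|je] := boolP (odd j).
    by right; split=> //; split=> //; rewrite xk QE e1 -signr_odd jo expr1 mulN1r -exprnN.
  left; split; first by rewrite xk QE e1 -signr_odd (negPf je) expr0 mul1r.
  by rewrite -(odd_double_half j) (negPf je) add0n it2.
- by case: xkq => xkq fj; apply: rk; rewrite xkq -{1}fj rt.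
have xN : x ^+ N = 1.
  have /eigenvalueP[v vg v0] := gx.
  have vgi i : v *m map_mx iota (g ^+ i) = x ^+ i *: v.
    elim: i => [|i IH]; first by rewrite !expr0 map_mx1 mulmx1 scale1r.
    by rewrite exprSr map_mxM mulmxA IH -scalemxAl vg scalerA exprSr.
  have := vgi N; rewrite gN map_mx1 mulmx1 => E.
  have /eqP : (1 - x ^+ N) *: v = 0 by rewrite scalerBl scale1r -E subrr.
  by rewrite scaler_eq0 (negPf v0) orbF subr_eq0 eq_sym => /eqP.
have fj : iter j (map_poly s) f = map_poly s f.
  by rewrite -(odd_double_half j) jo add1n /= it2.
(* the exponent k (N - 1) stands for -k *)
have gkV : g ^+ (k * N.-1) = star (g ^+ k).
  rewrite star_exp mulnC exprM; congr (_ ^+ _).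
  have sg := hg e1; have us : star g *m g = 1%:M by apply: mulmx1C.
  rewrite -[LHS]mul1r -[1]us -[_ * _]/(_ *m _) -mulmxA.
  have -> : g *m g ^+ N.-1 = g ^+ N by rewrite -[LHS]/(g * g ^+ N.-1) -exprS prednK.
  by rewrite gN mulmx1.
have := rk (map_poly s f) (k * N.-1)%N; rewrite gkV -rmorphXn horner_mx_star rank_star.
apply; have -> : x ^+ (k * N.-1) = x ^+ (q ^ j).
  apply: (mulrI (_ : x ^+ k \is a GRing.unit)).
    by rewrite unitfE expf_neq0 // (eigenvalue_unit_neq0 ug gx).
  rewrite -exprD -mulnS prednK // mulnC exprM xN expr1n xkq mulVf //.
  by rewrite expf_neq0 // (eigenvalue_unit_neq0 ug gx).
by rewrite -fj rt.
Qed.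

(** The inequality of ranks, applied to g and k and then to g^k and an inverse of k
modulo the order of g, is an equality. *)
Lemma power_similar g k N : (0 < N)%N -> g ^+ N = 1 -> coprime k N -> eps_unitary g ->
  (forall d, (1 <= d <= n)%N -> exists j, (k%:Z == Q ^+ j %[mod `|Q ^+ d - 1|%N])%Z) ->
  exists2 T, T \in unitmx & g *m T = T *m g ^+ k.
Proof.
move=> N0 gN ckN hg hk; apply: primary_rank_similar => f m fi.
apply/eqP; rewrite eqn_leq (rank_power_le _ N0 gN hg hk fi) andbT.
pose k' := (k ^ (totient N).-1)%N.
have kk' : g ^+ k ^+ k' = g.
  rewrite -exprM -expnS prednK ?totient_gt0 //.
  by rewrite -(expr_mod _ gN) (Euler_exp_totient ckN) (expr_mod _ gN) expr1.
rewrite -{1}kk'; apply: (rank_power_le _ N0) => //.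
- by rewrite exprAC gN expr1n.
- move=> e1; rewrite star_exp -[_ *m _]/(_ * _) -exprMn_comm.
    by rewrite -[g * _]/(g *m _) hg // expr1n.
  by rewrite /GRing.comm -![_ * _]/(_ *m _) hg // (mulmx1C (hg e1)).
- move=> d /hk[j kj]; exists (j * (totient N).-1)%N.
  by rewrite -[X in (X == _ %[mod _])%Z]natz natrX natz -modzXm (eqP kj) modzXm exprM.
Qed.
End PowerSimilarity.

(** * Matrices with a prescribed Frobenius orbit of eigenvalues *)

Lemma prim_root_ext (F : finFieldType) M : M%:R != 0 :> F ->
  exists (L : fieldExtType F) (z : L), M.-primitive_root z.
Proof.
move=> M0; have Mgt0 : (0 < M)%N by case: M M0 => //; rewrite eqxx.
have P0 : 'X^M - 1 != 0 :> {poly F} by rewrite -size_poly_gt0 size_XnsubC.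
have [L [rs Prs _]] := FinSplittingFieldFor P0.
exists L; rewrite rmorphB rmorph1 /= map_polyXn in Prs.
have M0L : M%:R != 0 :> L by rewrite -(rmorph_nat (in_alg L)) fmorph_eq0.
have urs : uniq rs.
  by rewrite -separable_prod_XsubC -(eqp_separable Prs) separable_Xn_sub_1.
have /hasP[z _ pz] : has M.-primitive_root rs.
  apply: has_prim_root => //.
    apply/allP => z zrs; apply/unity_rootP; apply/eqP.
    have : root ('X^M - 1) z by rewrite (eqp_root Prs) root_prod_XsubC.
    by rewrite rootE !hornerE subr_eq0.
  have := eqp_size Prs; rewrite size_XnsubC // size_prod_XsubC => [][->] //.
by exists z.
Qed.

Lemma prim_expz_eq1 (L : fieldType) M (z : L) (t : int) : M.-primitive_root z ->
  z ^ t = 1 -> (M %| t)%Z.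
Proof.
move=> pz; rewrite dvdzE /=; case: t => t /=.
  by rewrite -exprnP => /eqP; rewrite -(prim_order_dvd pz).
by rewrite NegzE -exprnN => /eqP; rewrite invr_eq1 -(prim_order_dvd pz).
Qed.

Section Conjugation.
Variables (K : fieldType) (n' : nat).
Local Notation n := n'.+1.
Implicit Types (A B T : 'M[K]_n).

Lemma eigenvalue_conj A B T c : T \in unitmx -> T *m A = B *m T ->
  eigenvalue B c -> eigenvalue A c.
Proof.
move=> uT TA /eigenvalueP[v vB v0]; apply/eigenvalueP; exists (v *m T).
  by rewrite -mulmxA TA mulmxA vB -scalemxAl.
by apply: contraNneq v0 => /(congr1 (mulmx^~ (invmx T))); rewrite mulmxK // mul0mx => ->.
Qed.

Lemma rank_horner_conj A B T p : T \in unitmx -> T *m A = B *m T ->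
  \rank (horner_mx A p) = \rank (horner_mx B p).
Proof.
move=> uT TA.
have TP : T *m horner_mx A p = horner_mx B p *m T.
  elim/poly_ind: p => [|p c IH]; first by rewrite !rmorph0 mulmx0 mul0mx.
  rewrite !rmorphD !rmorphM /= !horner_mx_C !horner_mx_X mulmxDr mulmxDl.
  rewrite -[_ * A]/(_ *m A) -[_ * B]/(_ *m B) mulmxA IH -mulmxA TA mulmxA.
  by rewrite scalar_mxC.
have := congr1 (@mxrank _ _ _) TP.
have fT : row_full T by rewrite row_full_unit.
by rewrite (eqmxMfull _ fT) mxrankMfree ?row_free_unit.
Qed.

Lemma eigenvalue_exp A c k : eigenvalue A c -> eigenvalue (A ^+ k) (c ^+ k).
Proof.
move=> /eigenvalueP[v vA v0]; apply/eigenvalueP; exists v => //.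
elim: k => [|i IH]; first by rewrite !expr0 mulmx1 scale1r.
by rewrite exprSr mulmxA IH -scalemxAl vA scalerA exprSr.
Qed.

Lemma eigenvalue_diag (a : 'I_n -> K) c :
  eigenvalue (diag_mx (\row_i a i)) c <-> exists i, a i = c.
Proof.
split=> [/eigenvalueP[v vD v0]|[i <-]].
  have /existsP[i vi] : [exists i, v 0 i != 0].
    apply: contraR v0 => /existsPn h; apply/eqP/rowP => i; rewrite mxE.
    by apply/eqP; have := h i; rewrite negbK.
  exists i; apply: (mulfI vi); have := congr1 (fun w : 'rV_n => w 0 i) vD.
  by rewrite mul_mx_diag !mxE mulrC => ->; rewrite mulrC.
apply/eigenvalueP; exists (delta_mx 0 i).
  by apply/rowP => j; rewrite mul_mx_diag !mxE /= mulrC; case: eqP => [->|_]; rewrite ?mulr0.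
by apply/eqP => /rowP/(_ i); rewrite !mxE !eqxx => /eqP; rewrite oner_eq0.
Qed.
End Conjugation.

(** Ranks do not change under field extension. *)
Lemma similar_descent (F : finFieldType) (L : fieldType) (iota : {rmorphism F -> L}) n'
   (A B : 'M[F]_n'.+1) (X : 'M[L]_n'.+1) : X \in unitmx ->
  X *m map_mx iota A = map_mx iota B *m X -> exists2 T, T \in unitmx & A *m T = T *m B.
Proof.
move=> uX XA; apply: rank_similar => p.
rewrite -(mxrank_map iota) -[RHS](mxrank_map iota) !map_horner_mx.
exact: rank_horner_conj XA.
Qed.

Section OrbitMatrix.
(* d is the length of the orbit of z under x |-> x^Q *)
Variables (F : finFieldType) (L : fieldExtType F) (n' : nat) (Q : int) (z : L).
Local Notation n := n'.+1.
Hypothesis injQ : forall x y : L, x ^ Q = y ^ Q -> x = y.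
Variable d : nat.
Hypotheses (d0 : (0 < d)%N) (dn : (d <= n)%N) (zd : z ^ (Q ^+ d) = z).
Hypothesis dmin : forall i, (0 < i < d)%N -> z ^ (Q ^+ i) != z.

Definition orbit_val (i : 'I_n) : L := if (i < d)%N then z ^ (Q ^+ i) else 1.

Definition orbit_next (i : 'I_n) : 'I_n := if (i < d)%N then inord (i.+1 %% d) else i.

Lemma orbit_next_inj : injective orbit_next.
Proof.
move=> i j; rewrite /orbit_next.
have dlt x : (x %% d < n)%N by apply: leq_trans dn; rewrite ltn_pmod.
have D : forall i : 'I_n, (i < d)%N -> forall j : 'I_n, ~~ (j < d)%N -> inord (i.+1 %% d) <> j.
  move=> i1 i1d j1 j1d /(congr1 val); rewrite /= inordK // => E.
  by move: j1d; rewrite -E ltn_pmod.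
case: ifP => id; case: ifP => jd; last by [].
- move/(congr1 val); rewrite /= !inordK // => E; apply: val_inj => /=.
  have /eqP : (1 + i = 1 + j %[mod d])%N by rewrite !add1n.
  by rewrite eqn_modDl !modn_small // => /eqP.
- by move/D => /(_ id); rewrite jd => /(_ isT).
- by move/esym/D => /(_ jd); rewrite id => /(_ isT).
Qed.

Definition orbit_perm : 'S_n := perm orbit_next_inj.

Lemma orbit_perm_lt (i : 'I_n) : (orbit_perm i < d)%N = (i < d)%N.
Proof.
rewrite permE /orbit_next; case: ifP => // id.
by rewrite inordK ?ltn_pmod //; apply: leq_trans dn; rewrite ltn_pmod.
Qed.

Lemma orbit_perm_id (i : 'I_n) : (d <= i)%N -> orbit_perm i = i.
Proof. by move=> di; rewrite permE /orbit_next ltnNge di. Qed.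

Lemma orbit_valQ i : orbit_val i ^ Q = orbit_val (orbit_perm i).
Proof.
rewrite permE /orbit_val /orbit_next; case: ifP => id; last by rewrite id exp1rz.
rewrite inordK ?ltn_pmod //; last by apply: leq_trans dn; rewrite ltn_pmod.
rewrite exprz_exp -exprSr.
have [lt|ge] := ltnP i.+1 d; first by rewrite modn_small.
have -> : i.+1 = d by apply/eqP; rewrite eqn_leq ge id.
by rewrite modnn expr0 zd.
Qed.

Lemma orbit_val_inj (i j : nat) : (i < d)%N -> (j < d)%N ->
  z ^ (Q ^+ i) = z ^ (Q ^+ j) -> i = j.
Proof.
have inX m (y1 y2 : L) : y1 ^ (Q ^+ m) = y2 ^ (Q ^+ m) -> y1 = y2.
  elim: m y1 y2 => [|m IH] y1 y2; first by rewrite !expr0.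
  by rewrite !exprS -!exprz_exp => /IH/injQ.
wlog ij : i j / (i <= j)%N.
  by move=> W id jd E; case/orP: (leq_total i j) => /W; [|move=> /(_ jd id (esym E)) ->]; auto.
move=> id jd E; apply/eqP; apply: contraT => nij.
have lt : (i < j)%N by rewrite ltn_neqAle nij.
have : (0 < j - i < d)%N by lia.
move/dmin/eqP; case; apply: (inX i); rewrite exprz_exp -exprD subnK //.
Qed.

(** A Vandermonde block on the orbit of z, completed by an identity block. *)
Definition orbit_mx : 'M[L]_n := \matrix_(i, j)
  if (i < d)%N then (if (j < d)%N then orbit_val i ^+ j else 0) else (i == j)%:R.

Lemma orbit_mx_unit : orbit_mx \in unitmx.
Proof.
rewrite -unitmx_tr -row_free_unit -kermx_eq0; apply/rowV0P => u /sub_kermxP uT.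
have uE i : \sum_j u 0 j * orbit_mx i j = 0.
  have := congr1 (fun w : 'rV_n => w 0 i) uT; rewrite !mxE => E; rewrite -[RHS]E.
  by apply: eq_bigr => j _; rewrite [orbit_mx^T _ _]mxE.
pose P := \poly_(j < d) u 0 (inord j).
have P0 : P = 0.
  apply/eqP; apply: contraT => Pn0.
  have urs : uniq [seq z ^ (Q ^+ i) | i <- seq.iota 0 d].
    rewrite map_inj_in_uniq ?iota_uniq // => i j; rewrite !mem_iota !add0n /= => id jd.
    exact: orbit_val_inj.
  have ars : all (root P) [seq z ^ (Q ^+ i) | i <- seq.iota 0 d].
    apply/allP => _ /mapP[i + ->]; rewrite mem_iota add0n /= => id.
    have iN := leq_trans id dn.
    rewrite /root horner_poly; apply/eqP; rewrite -[RHS](uE (Ordinal iN)).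
    rewrite (big_ord_widen _ (fun j => u 0 (inord j) * (z ^ (Q ^+ i)) ^+ j) dn) big_mkcond /=.
    apply: eq_bigr => j _; rewrite mxE /= id /orbit_val /= id inord_val.
    by case: ifP; rewrite ?mulr0.
  have := max_poly_roots Pn0 ars urs; rewrite size_map size_iota ltnNge.
  by rewrite size_poly.
apply/rowP => j; rewrite mxE.
have [jd|jd] := ltnP j d.
  by have := congr1 (fun r : {poly L} => r`_j) P0; rewrite coef0 coef_poly jd inord_val.
have := uE j; rewrite (bigD1 j) //= mxE ltnNge jd /= eqxx mulr1 big1 ?addr0 // => i ij.
by rewrite mxE ltnNge jd /= eq_sym (negPf ij) mulr0.
Qed.

(** As phi permutes the rows of orbit_mx and the diagonal entries in the same way, it
fixes the conjugated matrix. *)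
Lemma orbit_mx_frobenius (phi : {rmorphism L -> L}) (s : 'S_n) :
  (forall i, phi (orbit_val i) = orbit_val (s i)) ->
  (forall i : 'I_n, (s i < d)%N = (i < d)%N) -> (forall i : 'I_n, (d <= i)%N -> s i = i) ->
  let B := invmx orbit_mx *m diag_mx (\row_i orbit_val i) *m orbit_mx in
  map_mx phi B = B.
Proof.
move=> phis sd sf B.
have TB : orbit_mx *m B = diag_mx (\row_i orbit_val i) *m orbit_mx.
  by rewrite /B !mulmxA mulmxV ?orbit_mx_unit // mul1mx.
have phiT i j : phi (orbit_mx i j) = orbit_mx (s i) j.
  rewrite !mxE sd; case: ifP => id; first by case: ifP => jd;
    rewrite ?rmorph0 // rmorphXn /= phis.
  by rewrite rmorph_nat sf // leqNgt id.
have TBe i j : \sum_l orbit_mx i l * B l j = orbit_val i * orbit_mx i j.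
  have := congr1 (fun X : 'M_n => X i j) TB.
  by rewrite mul_diag_mx [LHS]mxE [RHS]mxE [(\row_i _) _ _]mxE.
apply: (can_inj (mulKmx orbit_mx_unit)); rewrite TB; apply/matrixP => i j.
rewrite mul_diag_mx [LHS]mxE [RHS]mxE [(\row_i _) _ _]mxE.
have := congr1 phi (TBe ((s^-1)%g i) j); rewrite rmorphM rmorph_sum /= phis phiT permKV => <-.
by apply: eq_bigr => l _; rewrite rmorphM phiT permKV [map_mx _ _ _ _]mxE.
Qed.
End OrbitMatrix.

Section OrbitElement.
Variables (p e q : nat) (eps : int) (F : finFieldType) (n' : nat) (s : {rmorphism F -> F}).
Local Notation n := n'.+1.
Hypotheses (pF : p \in [pchar F]) (hq : q = (p ^ e)%N) (e_gt0 : (0 < e)%N).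
Hypotheses (heps : eps = 1 \/ eps = -1) (sE : forall x, s x = x ^+ q).
Hypotheses (s1 : eps = 1 -> s =1 id) (sN : eps = -1 -> involutive s).
Hypothesis cardF : #|F| = GLeps_card eps q.
Local Notation Q := (eps * q%:Z).

(** Q vanishes in F, so Q^d - 1 is -1 there. *)
Lemma modulus_neq0 d : (0 < d)%N -> `|Q ^+ d - 1|%N%:R != 0 :> F.
Proof.
move=> d0; have p0 : p%:R = 0 :> F by have /andP[_ /eqP] := pF.
have QF : (Q ^+ d - 1)%:~R = -1 :> F.
  rewrite rmorphB rmorphXn rmorphM /= rmorph1 hq.
  have -> : ((p ^ e)%N%:Z)%:~R = 0 :> F by rewrite -pmulrn natrX p0 expr0n; case: (e) e_gt0.
  by rewrite mulr0 expr0n; case: (d) d0 => // m _; rewrite sub0r.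
have : (Q ^+ d - 1)%:~R != 0 :> F by rewrite QF oppr_eq0 oner_eq0.
case: (Q ^+ d - 1) => m; first by rewrite -pmulrn.
by rewrite NegzE abszN mulrNz oppr_eq0 -pmulrn.
Qed.

Lemma fixed_in_base (L : fieldExtType F) (x : L) : x ^+ #|F| = x -> exists y : F, in_alg L y = x.
Proof.
move=> xF; have : x \in 1%VS by rewrite (@Fermat's_little_theorem F L 1%AS) dimv1 expn1 xF.
by case/vlineP => y ->; exists y.
Qed.

(** With m the length of the orbit of z, the matrix is the diagonal matrix of the orbit
conjugated by orbit_mx; it is fixed by the Frobenius map x |-> x^|F|, which acts on the
orbit as x |-> x^Q or its square, so it has entries in F. *)
Lemma orbit_element d : (1 <= d <= n)%N ->
  exists (L : fieldExtType F) (z : L) (B : 'M[F]_n) (T : 'M[L]_n) (a : 'I_n -> L) (w : 'S_n),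
  [/\ `|Q ^+ d - 1|%N.-primitive_root z, T \in unitmx,
      T *m map_mx (in_alg L) B = diag_mx (\row_i a i) *m T,
      (forall i, a (w i) = a i ^ Q) /\ (forall i, a i = 1 \/ exists j, a i = z ^ (Q ^+ j))
    & exists i, a i = z].
Proof.
case/andP => d0 dn.
have [L [z pz]] := prim_root_ext (modulus_neq0 d0); exists L, z.
have M0 := prim_order_gt0 pz.
have zu := prim_root_unitr pz.
have z0 : z != 0 by rewrite -unitfE.
have zd : z ^ (Q ^+ d) = z.
  rewrite (exprz_eqmod zu (prim_expr_order pz) (_ : (_ == 1 %[mod _])%Z)) //.
  by apply: expz_eq1_modulus.
pose P i := (0 < i)%N && (z ^ (Q ^+ i) == z).
have exP : exists i, P i by exists d; rewrite /P d0 zd eqxx.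
case: (ex_minnP exP) => m /andP[m0 /eqP zm] mmin.
have md : (m <= d)%N by apply: mmin; rewrite /P d0 zd eqxx.
have mn := leq_trans md dn.
have dmin i : (0 < i < m)%N -> z ^ (Q ^+ i) != z.
  move=> /andP[i0 im]; apply: contraTneq im => zi; rewrite -leqNgt; apply: mmin.
  by rewrite /P i0 zi eqxx.
have injQ := power_inj pF hq heps sE (in_alg L : {rmorphism F -> L}).
pose a := @orbit_val F L n' Q z m; pose w : 'S_n := orbit_perm m0 mn.
pose T := @orbit_mx F L n' Q z m.
have uT : T \in unitmx := orbit_mx_unit injQ m0 mn dmin.
have aw i : a i ^ Q = a (w i) := orbit_valQ m0 mn zm i.
pose B' := invmx T *m diag_mx (\row_i a i) *m T.
have [phi [phiE phia]] : exists phi : {rmorphism L -> L}, (forall x, phi x = x ^+ #|F|) /\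
    exists w' : 'S_n, [/\ (forall i, phi (a i) = a (w' i)),
     (forall i : 'I_n, (w' i < m)%N = (i < m)%N) & (forall i : 'I_n, (m <= i)%N -> w' i = i)].
  have pL : p \in [pchar L] by rewrite (fmorph_pchar (in_alg L : {rmorphism F -> L})).
  have wlt (i : 'I_n) : (w i < m)%N = (i < m)%N by apply: orbit_perm_lt.
  have wid (i : 'I_n) : (m <= i)%N -> w i = i by apply: orbit_perm_id.
  case: heps => e1.
    have cF : #|F| = (p ^ e)%N by rewrite cardF e1 hq.
    have [phi phiE] := frobenius_power_morphism e pL.
    exists phi; split=> [x|]; first by rewrite phiE cF.
    by exists w; split=> // i; rewrite -aw phiE -hq e1 mul1r.
  have cF : #|F| = (p ^ (e * 2))%N by rewrite cardF e1 hq expnM.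
  have [phi phiE] := frobenius_power_morphism (e * 2)%N pL.
  exists phi; split=> [x|]; first by rewrite phiE cF.
  exists (w * w)%g; split=> i; rewrite ?permM ?wlt //; last by move=> mi; rewrite !wid.
  rewrite -!aw exprz_exp phiE expnM -hq e1 mulN1r mulrNN -PoszM -exprnP.
  by congr (_ ^+ _).
have fixB : map_mx phi B' = B'.
  have [w' [h1 h2 h3]] := phia.
  exact: (orbit_mx_frobenius injQ m0 mn dmin h1 h2 h3).
have BF i j : exists y : F, in_alg L y == B' i j.
  have [|y Ey] := @fixed_in_base L (B' i j); last by exists y; rewrite Ey.
  by rewrite -phiE; have := congr1 (fun X : 'M_n => X i j) fixB; rewrite mxE.
pose B := \matrix_(i, j) xchoose (BF i j).
have BE : map_mx (in_alg L) B = B'.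
  by apply/matrixP => i j; rewrite mxE mxE (eqP (xchooseP (BF i j))).
exists B, T, a, w; split=> //.
- by rewrite BE /B' !mulmxA mulmxV // mul1mx.
- split=> i; first by rewrite aw.
  by rewrite /a /orbit_val; case: ifP => _; [right; exists i | left].
- by exists ord0; rewrite /a /orbit_val /= m0.
Qed.
End OrbitElement.

(** * Unitary matrices with prescribed eigenvalues *)

Section StarInvolution.
Variables (F : finFieldType) (n' : nat) (s : {rmorphism F -> F}).
Hypothesis sK : involutive s.
Local Notation n := n'.+1.

Lemma star_zmod : zmod_morphism (@star F n' s).
Proof. by move=> A B; rewrite /star map_mxB linearB. Qed.
HB.instance Definition _ := GRing.isZmodMorphism.Build 'M[F]_n 'M[F]_n (@star F n' s) star_zmod.

Lemma starM (A B : 'M[F]_n) : star s (A * B) = star s B * star s A.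
Proof. by rewrite /star map_mxM trmx_mul. Qed.

Lemma starK : involutive (@star F n' s).
Proof. by move=> A; apply/matrixP => i j; rewrite !mxE sK. Qed.

Lemma star_scalar (c : F) : star s (c%:M : 'M[F]_n) = (s c)%:M.
Proof. by rewrite /star map_scalar_mx tr_scalar_mx. Qed.

Lemma scalar_central (c : F) : central (c%:M : 'M[F]_n).
Proof. by move=> A; exact/esym/scalar_mxC. Qed.

Lemma scalar_sub_unit (c : F) : s c != c -> c%:M - star s c%:M \is a @GRing.unit 'M[F]_n.
Proof.
move=> sc; rewrite star_scalar -raddfB /= -[_ \is a _]/(_ \in unitmx) unitmxE det_scalar.
by rewrite unitfE expf_neq0 // subr_eq0 eq_sym.
Qed.
End StarInvolution.

Section Fields.
Variables (p e q : nat) (eps : int) (F : finFieldType) (n' : nat) (s : {rmorphism F -> F}).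
Local Notation n := n'.+1.
Hypotheses (pF : p \in [pchar F]) (hq : q = (p ^ e)%N) (e_gt0 : (0 < e)%N).
Hypotheses (heps : eps = 1 \/ eps = -1) (sE : forall x, s x = x ^+ q).
Hypotheses (s1 : eps = 1 -> s =1 id) (sN : eps = -1 -> involutive s).
Hypothesis cardF : #|F| = GLeps_card eps q.
Local Notation Q := (eps * q%:Z).

Lemma q_gt1 : (1 < q)%N.
Proof.
have /andP[pp _] := pF; rewrite hq -(exp1n e) ltn_exp2r //; exact: prime_gt1.
Qed.

Lemma moved_scalar : eps = -1 -> exists c, s c != c.
Proof.
move=> e1; apply/existsP; apply: contraT => /existsPn sid.
have P0 : 'X^q - 'X != 0 :> {poly F}.
  by rewrite -size_poly_gt0 size_polyDl ?size_polyXn // size_polyN size_polyX ltnS q_gt1.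
have aP : all (root ('X^q - 'X)) (enum F).
  apply/allP => c _; rewrite rootE !hornerE subr_eq0.
  by have := sid c; rewrite negbK sE.
have := max_poly_roots P0 aP (enum_uniq F).
rewrite size_polyDl ?size_polyXn ?size_polyN ?size_polyX ?ltnS ?q_gt1 // -cardE cardF e1 /GLeps_card /=.
by rewrite leqNgt -{1}[q]expn1 ltn_exp2l ?q_gt1.
Qed.

(** Over L, the matrix B is similar to the diagonal matrix of the a i, and the inverse of
star B to that of the (a i)^-q = a (w i), a permutation of the same entries.
So B and the inverse of star B are similar over L, hence over F. *)
Lemma conjugate_into_unitary (L : fieldExtType F) (B : 'M[F]_n) (T : 'M[L]_n) (a : 'I_n -> L) (w : 'S_n) :
  eps = -1 -> B \in unitmx -> T \in unitmx -> (forall i, a i != 0) ->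
  T *m map_mx (in_alg L) B = diag_mx (\row_i a i) *m T ->
  (forall i, a (w i) = a i ^ Q) ->
  exists g y, [/\ y \in unitmx, g \in unitmx, g *m star s g = 1%:M & B *m y = y *m g].
Proof.
move=> e1 uB uT a0 TB aw.
have [sL [sLE sLm]] := frobenius_ext pF hq sE (in_alg L : {rmorphism F -> L}).
have sLi (x : F) : sL (in_alg L x) = in_alg L (s x) by rewrite sLE sE rmorphXn.
pose S : 'M[L]_n := map_mx (in_alg L) (star s B).
have SE : S = (map_mx sL (map_mx (in_alg L) B))^T.
  by apply/matrixP => i j; rewrite !mxE sLi.
pose Y := (map_mx sL T)^T.
have uY : Y \in unitmx by rewrite unitmx_tr map_unitmx.
pose Da := diag_mx (\row_i a i); pose Dw := diag_mx (\row_i a (w i)).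
have SY : S *m Y = Y *m map_mx sL Da.
  rewrite SE -trmx_mul -map_mxM TB map_mxM trmx_mul; congr (_ *m _).
  by rewrite map_diag_mx tr_diag_mx.
have DD : map_mx sL Da *m Dw = 1%:M.
  rewrite map_diag_mx mulmx_diag -diag_const_mx; congr diag_mx; apply/rowP => i; rewrite !mxE.
  by rewrite aw e1 mulN1r -exprnN sLE mulfV // expf_neq0.
have PD : perm_mx w *m Da = Dw *m perm_mx w.
  apply/matrixP => i j; rewrite mul_mx_diag mul_diag_mx !mxE.
  by case: eqP => [->|_]; rewrite ?mul1r ?mulr1 // mul0r mulr0.
have uS : star s B \in unitmx by rewrite unitmx_tr map_unitmx.
pose X := Y *m perm_mx w *m T.
have uX : X \in unitmx by rewrite !unitmx_mul uY unitmx_perm uT.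
have XE : X *m map_mx (in_alg L) B = map_mx (in_alg L) (invmx (star s B)) *m X.
  have uSL : S \in unitmx by rewrite map_unitmx.
  apply: (can_inj (mulKmx uSL)); rewrite map_invmx -/S [RHS]mulmxA mulmxV // mul1mx.
  rewrite /X -!mulmxA TB [perm_mx w *m (_ *m T)]mulmxA PD -!mulmxA.
  by rewrite [S *m _]mulmxA SY -mulmxA [map_mx sL _ *m _]mulmxA DD mul1mx.
have [x ux Bx] := similar_descent uX XE.
have [c /(scalar_sub_unit n') uc] := moved_scalar e1.
have sC : central (@star F n' s (c%:M)) by rewrite star_scalar; apply: scalar_central.
pose b := FinRing.Unit (uB : B \is a GRing.unit).
pose x' := FinRing.Unit (ux : x \is a GRing.unit).
have := @unitary_form _ (@star F n' s) c%:M (@starM F n' s) (starK (sN e1)) (@scalar_central F n' c) sC uc b x'.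
case=> [|y gy]; first by apply: val_inj; rewrite /= -[RHS]/(B *m x) Bx.
exists (val (y^-1 * b * y)%g), (val y); split.
- exact: (valP y).
- exact: (valP (y^-1 * b * y)%g).
- by have := congr1 val gy.
- have : (b * y = y * (y^-1 * b * y))%g by rewrite !mulgA mulgV mul1g.
  by move/(congr1 val).
Qed.

(** If z of order M_d is an eigenvalue of g, and g is similar to g^k, then z^k is an
eigenvalue of g. *)
Lemma modulus_of_similar_powers k d : (1 <= d <= n)%N -> coprime k `|Q ^+ d - 1| ->
  (forall g : 'M[F]_n, g \in unitmx -> eps_unitary eps s g ->
      exists2 T, T \in unitmx & g *m T = T *m g ^+ k) ->
  exists j, (k%:Z == Q ^+ j %[mod `|Q ^+ d - 1|%N])%Z.
Proof.
move=> dn ck hk.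
have [L [z [B [T [a [w [pz uT TB [aw aE] [i0 ai0]]]]]]]] := orbit_element pF hq e_gt0 heps sE cardF dn.
have M0 := prim_order_gt0 pz.
have zu := prim_root_unitr pz.
have a0 i : a i != 0.
  by case: (aE i) => [->|[j ->]]; rewrite ?oner_eq0 // expfz_neq0 // -unitfE.
have uB : B \in unitmx.
  rewrite -(map_unitmx (in_alg L));
    have -> : map_mx (in_alg L) B = invmx T *m diag_mx (\row_i a i) *m T.
    by rewrite -mulmxA -TB mulKmx.
  rewrite !unitmx_mul unitmx_inv uT andbT /= unitmxE det_diag unitfE.
  by apply/prodf_neq0 => i _; rewrite mxE.
have [g [y [uy ug hg By]]] : exists g y, [/\ y \in unitmx, g \in unitmx, eps_unitary eps s g & B *m y = y *m g].
  case: heps => e1; first by exists B, 1%:M; rewrite unitmx1 mulmx1 mul1mx; split=> // e2;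
    rewrite e2 in e1.
  have [g [y [uy ug hg By]]] := conjugate_into_unitary e1 uB uT a0 TB aw.
  by exists g, y; split.
have [X uX gX] := hk g ug hg.
pose gL := map_mx (in_alg L) g.
have uTy : T *m map_mx (in_alg L) y \in unitmx by rewrite unitmx_mul uT map_unitmx.
have TyE : T *m map_mx (in_alg L) y *m gL = diag_mx (\row_i a i) *m (T *m map_mx (in_alg L) y).
  by rewrite -mulmxA -map_mxM -By map_mxM mulmxA TB -mulmxA.
have gz : eigenvalue gL z.
  by apply: (eigenvalue_conj uTy TyE); apply/eigenvalue_diag; exists i0.
have gkz : eigenvalue gL (z ^+ k).
  apply: (@eigenvalue_conj _ _ _ (map_mx (in_alg L) (g ^+ k)) (invmx (map_mx (in_alg L) X))).
  - by rewrite unitmx_inv map_unitmx.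
  - apply: (can_inj (mulKmx (_ : map_mx (in_alg L) X \in unitmx))); rewrite ?map_unitmx //.
    rewrite mulmxA mulmxV ?map_unitmx // mul1mx mulmxA -map_mxM -gX map_mxM -mulmxA mulmxV ?map_unitmx //.
    by rewrite mulmx1.
  - by rewrite rmorphXn /=; apply: eigenvalue_exp.
have /eigenvalue_diag[i aiE] : eigenvalue (diag_mx (\row_i a i)) (z ^+ k).
  apply: (@eigenvalue_conj _ _ _ gL (invmx (T *m map_mx (in_alg L) y))) gkz.
    by rewrite unitmx_inv.
  apply: (can_inj (mulKmx uTy)).
  by rewrite mulmxA mulmxV // mul1mx mulmxA TyE -mulmxA mulmxV // mulmx1.
case: (aE i) => [a1|[j aj]].
  exists 0%N; rewrite expr0; have : (`|Q ^+ d - 1| %| k)%N by rewrite (prim_order_dvd pz) -aiE a1.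
  move/gcdn_idPr; rewrite gcdnC; have := eqP ck; rewrite gcdnC => -> <-.
  by rewrite eqz_mod_dvd dvdzE dvd1n.
exists j; rewrite eqz_mod_dvd; apply: (prim_expz_eq1 pz).
by rewrite exprzDr // -exprnP -aiE aj -exprzDr // subrr.
Qed.
End Fields.

(** * Galois descent to a generated subfield *)

Section FieldClosure.
Variables (K : {pred algC}) (hK : divring_closed K).
HB.instance Definition _ := GRing.isDivringClosed.Build algC K hK.

Lemma Fadjoin_image (Qn : splittingFieldType rat) (QnC : {rmorphism Qn -> algC}) (bs : seq Qn) :
  (forall b, b \in bs -> QnC b \in K) -> forall a, a \in <<1 & bs>>%VS -> QnC a \in K.
Proof.
elim/last_ind: bs => [|bs b IH] hbs a.
  rewrite Fadjoin_nil => /vlineP[c ->].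
  have <- : ratr c = QnC c%:A.
    by rewrite -[LHS](fmorph_eq_rat (QnC \o in_alg Qn : {rmorphism rat -> algC})).
  exact/rpred_Crat/Crat_rat.
rewrite adjoin_rcons => /Fadjoin_polyP[P PK ->].
rewrite -horner_map horner_coef; apply: rpred_sum => i _.
rewrite coef_map rpredM //=.
  apply: IH => [c cbs|]; first by apply: hbs; rewrite mem_rcons inE cbs orbT.
  exact: (polyOverP PK).
by rewrite rpredX // hbs // mem_rcons mem_head.
Qed.
End FieldClosure.

(** Such sums are the elements that automorphisms of algC act on through their action on
N-th roots of unity; periods and character values are given in this form. *)
Definition root_sum N (x : algC) :=
  exists2 rs : seq algC, all (fun z => z ^+ N == 1) rs & x = \sum_(z <- rs) z.

(** The Galois correspondence in the N-th cyclotomic field, for its subfield generated by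
the finite list ss. *)
Lemma Qadjoin_of_fixed N (S : algC -> Prop) (ss : seq algC) x : (0 < N)%N ->
  (forall y, y \in ss -> S y) -> (forall y, y \in ss -> root_sum N y) -> root_sum N x ->
  (forall (nu : {rmorphism algC -> algC}) k, coprime k N ->
     (forall z, z ^+ N = 1 -> nu z = z ^+ k) ->
     (forall y, y \in ss -> nu y = y) -> nu x = x) ->
  Qadjoin S x.
Proof.
move=> N0 ssS ssN xN fix_x K hK SK.
have [Qn galQn [QnC gQnC [w [pw _] _]]] := group_num_field_exists (Zp N).
rewrite card_Zp // in pw.
have pz : N.-primitive_root (QnC w) by rewrite fmorph_primitive_root.
have preim y : root_sum N y -> {a | QnC a == y}.
  move=> yN; apply: sigW; case: yN => rs /allP rsN ->.
  elim: rs rsN => [|z rs IH] rsN; first by exists 0; rewrite big_nil rmorph0.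
  have [a /eqP Ea] := IH (fun t trs => rsN t (mem_behead (s := z :: rs) trs)).
  have /eqP/(prim_rootP pz)[i Ei] := rsN z (mem_head _ _).
  by exists (w ^+ i + a); rewrite big_cons rmorphD rmorphXn /= Ea -Ei.
have {ssN}[bs Dbs] : exists bs : seq Qn, map QnC bs = ss.
  elim: ss ssN {ssS fix_x} => [|y ss IH] ssN; first by exists [::].
  have [bs Eb] := IH (fun t tss => ssN t (mem_behead (s := y :: ss) tss)).
  have [b /eqP Eb0] := preim y (ssN y (mem_head _ _)).
  by exists (b :: bs); rewrite /= Eb Eb0.
have [a /eqP Ea] := preim x xN.
rewrite -Ea; apply: (Fadjoin_image hK (bs := bs)) => [b bbs|].
  by apply/SK/ssS; rewrite -Dbs map_f.
pose E : {subfield Qn} := <<1 & bs>>%AS.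
have galE : galois E {:Qn} by apply: galoisS galQn; rewrite sub1v subvf.
rewrite -[<<1 & bs>>%VS]/(E : {vspace Qn}) -(galois_fixedField galE).
apply/fixedFieldP; first exact: memvf.
move=> sg sgE; apply: (fmorph_inj QnC).
have [nu nuE] := gQnC sg; rewrite nuE Ea.
have /(prim_rootP pw)[k sgw] : sg w ^+ N = 1.
  by rewrite -rmorphXn (prim_expr_order pw) rmorph1.
have psg : N.-primitive_root (w ^+ k) by rewrite -sgw fmorph_primitive_root.
apply: (fix_x nu k).
- by rewrite -(prim_root_exp_coprime _ pw).
- move=> z /(prim_rootP pz)[i ->]; rewrite rmorphXn /= -nuE sgw rmorphXn /=.
  by rewrite exprAC.
- move=> y; rewrite -Dbs => /mapP[b bbs ->]; rewrite -nuE; congr (QnC _).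
  by apply: (fixed_gal _ sgE); [exact: subvf | apply: seqv_sub_adjoin].
Qed.

Lemma Qadjoin_trans (S S' : algC -> Prop) x :
  (forall y, S y -> Qadjoin S' y) -> Qadjoin S x -> Qadjoin S' x.
Proof. by move=> SS Sx K hK S'K; apply: (Sx K hK) => y /SS Sy; exact: Sy hK S'K. Qed.

(** * Character values under Galois conjugation and power maps *)

Section CharacterValues.
Variables (gT : finGroupType) (G : {group gT}).

(** The restriction of a representation to a cyclic group is diagonalizable. *)
Lemma char_eigenvalues (i : Iirr G) g : g \in G -> exists rs : seq algC,
  all (fun z => z ^+ #[g]%g == 1) rs /\ forall k, 'chi_i (g ^+ k)%g = \sum_(z <- rs) z ^+ k.
Proof.
move=> gG; have /char_reprP[[n rG] ->] := irr_char i.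
have [e [[B uB rgE] [e1 _] _ _]] := repr_rsim_diag rG gG.
exists [seq e 0 j | j : 'I_n]; split.
  by apply/allP => _ /imageP[j _ ->]; rewrite e1.
move=> k; rewrite cfunE groupX // mulr1n big_image /=.
case: n rG e B uB rgE e1 => [|n] rG e B uB rgE e1; first by rewrite /mxtrace !big_ord0.
rewrite repr_mxX // rgE.
have -> : (invmx B *m diag_mx e *m B) ^+ k = invmx B *m diag_mx (map_mx (fun x => x ^+ k) e) *m B.
  elim: k => [|k IH].
    rewrite expr0 (_ : diag_mx _ = 1%:M) ?mulmx1 ?mulVmx //.
    by rewrite -diag_const_mx; congr diag_mx; apply/rowP => j; rewrite !mxE.
  rewrite exprSr IH -[_ * _]/(_ *m _) !mulmxA mulmxK //; congr (_ *m _).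
  rewrite -mulmxA mulmx_diag; congr (_ *m diag_mx _); apply/rowP => j; rewrite !mxE.
  by rewrite exprSr.
rewrite mxtrace_mulC mulmxA mulmxV // mul1mx mxtrace_diag.
by apply: eq_bigr => j _; rewrite mxE.
Qed.

Lemma char_root_sum N (i : Iirr G) g : (#|G| %| N)%N -> g \in G -> root_sum N ('chi_i g).
Proof.
move=> GN gG; have [rs [/allP rs1 rsE]] := char_eigenvalues i gG.
exists rs; last by rewrite -[g]expg1 rsE; apply: eq_bigr => z _; rewrite expr1.
apply/allP => z /rs1 /eqP z1; have /dvdnP[m ->] := dvdn_trans (order_dvdG gG) GN.
by rewrite mulnC exprM z1 expr1n.
Qed.

Lemma aut_char N (nu : {rmorphism algC -> algC}) k (i : Iirr G) g : (#|G| %| N)%N -> g \in G ->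
  (forall z, z ^+ N = 1 -> nu z = z ^+ k) -> nu ('chi_i g) = 'chi_i (g ^+ k)%g.
Proof.
move=> GN gG nuE; have [rs [/allP rs1 rsE]] := char_eigenvalues i gG.
rewrite rsE -{1}[g]expg1 rsE rmorph_sum; apply: eq_big_seq => z /rs1 /eqP z1.
rewrite expr1 nuE //; have /dvdnP[m ->] := dvdn_trans (order_dvdG gG) GN.
by rewrite mulnC exprM z1 expr1n.
Qed.

(** Otherwise the second orthogonality relation would give the value 0 for the sum of the
chi(y) * conj (chi(y)), which is the order of the centralizer of y. *)
Lemma irr_separates_classes x y : x \in G -> y \in G ->
  (forall i : Iirr G, 'chi_i x = 'chi_i y) -> x \in (y ^: G)%g.
Proof.
move=> xG yG xy; have := second_orthogonality_relation x yG.
have -> : \sum_i 'chi[G]_i x * ('chi_i y)^* = \sum_i 'chi[G]_i y * ('chi_i y)^*.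
  by apply: eq_bigr => i _; rewrite xy.
rewrite second_orthogonality_relation // class_refl mulr1n.
case: (x \in _) => // /eqP; rewrite mulr0n pnatr_eq0 => /eqP c0.
by have := cardG_gt0 'C_G[y]; rewrite c0.
Qed.
End CharacterValues.

Lemma herm_formE n' (F : finFieldType) q (s : {rmorphism F -> F}) (u v : 'rV[F]_n'.+1) :
  (forall x, s x = x ^+ q) ->
  herm_form q (u : 'rV[F]_(n'.+1).-1.+1) v = (u *m (map_mx s v)^T) 0 0.
Proof. by move=> sE; rewrite mxE; apply: eq_bigr => i _; rewrite !mxE sE. Qed.

(** The form u g star g star v evaluated on the standard basis gives the entries of g * star g. *)
Lemma mem_GLeps (eps : int) n' (F : finFieldType) q (s : {rmorphism F -> F})
   (g : {'GL_n'.+1[F]}) : eps = 1 \/ eps = -1 -> (forall x, s x = x ^+ q) ->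
  g \in GLeps eps n'.+1 F q <-> eps_unitary eps s (GLval g : 'M[F]_n'.+1).
Proof.
move=> heps sE; case: heps => e1; rewrite /GLeps /eps_unitary e1 /=.
  by rewrite inE; split.
have hE (u v : 'rV[F]_n'.+1) :
    herm_form q (u *m GLval g : 'rV[F]_(n'.+1).-1.+1) (v *m GLval g)
    = (u *m ((GLval g : 'M[F]_n'.+1) *m star s (GLval g : 'M[F]_n'.+1)) *m (map_mx s v)^T) 0 0.
  by rewrite (herm_formE _ _ sE) map_mxM trmx_mul !mulmxA.
rewrite inE; split=> [/forallP gU _|gU].
  apply/matrixP => i j; have /forallP/(_ (delta_mx 0 j))/eqP := gU (delta_mx 0 i).
  rewrite hE (herm_formE _ _ sE) map_delta_mx trmx_delta -rowE -colE.
  rewrite [LHS]mxE [LHS]mxE => ->.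
  by rewrite -rowE !mxE eqxx andbT.
apply/forallP => u; apply/forallP => v; apply/eqP.
by rewrite hE (herm_formE _ _ sE) (gU erefl) mulmx1.
Qed.

(** * The two fields have the same stabilizer *)

Lemma sum_periodic (V : zmodType) (f : nat -> V) d j : (forall i, f (i + d)%N = f i) ->
  \sum_(i < d) f (i + j)%N = \sum_(i < d) f i.
Proof.
move=> fd; elim: j => [|j IH]; first by apply: eq_bigr => i _; rewrite addn0.
rewrite -{}IH; apply: (addrI (f j)).
have := big_ord_recr d (fun i => f (i + j)%N) (op := +%R) (idx := 0).
rewrite /= big_ord_recl add0n /= [(d + j)%N]addnC fd [RHS]addrC => <-.
by congr (_ + _); apply: eq_bigr => i _; rewrite /bump leq0n addnS addSn.
Qed.

Section Glue.
Variables (p e q : nat) (eps : int) (F : finFieldType) (n' : nat) (s : {rmorphism F -> F}).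
Local Notation n := n'.+1.
Hypotheses (pF : p \in [pchar F]) (hq : q = (p ^ e)%N) (e_gt0 : (0 < e)%N).
Hypotheses (heps : eps = 1 \/ eps = -1) (sE : forall x, s x = x ^+ q).
Hypotheses (s1 : eps = 1 -> s =1 id) (sN : eps = -1 -> involutive s).
Hypothesis cardF : #|F| = GLeps_card eps q.
Local Notation Q := (eps * q%:Z).
Local Notation G := (GLeps eps n F q).
Local Notation M d := (`|(Q ^+ d - 1)%R|%N).

(** In the unitary group similarity over F is enough by [unitary_conj]. *)
Lemma conj_in_GLeps (g h : {'GL_n[F]}) (T : 'M[F]_n) : g \in G -> h \in G -> T \in unitmx ->
  (GLval g : 'M[F]_n) *m T = T *m GLval h -> h \in (g ^: G)%g.
Proof.
move=> gG hG uT gT.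
pose x : {'GL_n[F]} := FinRing.Unit (uT : (T : 'M[F]_n) \is a GRing.unit).
have gx : (g * x = x * h)%g by apply: val_inj.
suff [u uG ug] : exists2 u : {'GL_n[F]}, u \in G & (u * g = h * u)%g.
  apply/imsetP; exists u^-1%g; first by rewrite groupV.
  by rewrite conjgE invgK mulgA ug mulgK.
have xg : (x^-1 * g = h * x^-1)%g by apply: (mulIg x); rewrite mulgKV -mulgA gx mulKg.
case: (heps) => e1; first by exists x^-1%g; rewrite // /GLeps e1 /= inE.
have [c /(scalar_sub_unit n') uc] := moved_scalar pF hq e_gt0 sE cardF e1.
have sC : central (@star F n' s (c%:M)) by rewrite star_scalar; apply: scalar_central.
have gU (f : {'GL_n[F]}) : f \in G <-> (f * gst (@starM F n' s) (starK (sN e1)) f = 1)%g.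
  rewrite (mem_GLeps f heps sE); split=> [/(_ e1) fU|fU _]; first exact: val_inj.
  by have := congr1 val fU.
have [] := @unitary_conj _ (@star F n' s) c%:M (@starM F n' s) (starK (sN e1)) (@scalar_central F n' c) sC uc g h x^-1%g.
- exact/gU.
- exact/gU.
- exact: xg.
by move=> u uU ug; exists u => //; apply/gU.
Qed.

Lemma gammaE d : gamma eps q d = \sum_(k < d) xi (M d) ^ (Q ^+ k).
Proof. by rewrite /gamma modulus_signed. Qed.

Lemma modulus_gt0 d : (0 < d)%N -> (0 < M d)%N.
Proof.
move=> d0; have := modulus_neq0 eps pF hq e_gt0 d0; case: (M d) => //.
by rewrite eqxx.
Qed.

Lemma aut_gamma N (nu : {rmorphism algC -> algC}) k d : (0 < d)%N -> (M d %| N)%N ->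
  (forall z, z ^+ N = 1 -> nu z = z ^+ k) ->
  nu (gamma eps q d) = \sum_(i < d) xi (M d) ^ (k%:Z * Q ^+ i).
Proof.
move=> d0 MN nuE; rewrite gammaE rmorph_sum; apply: eq_bigr => i _.
have pz := xi_prim (modulus_gt0 d0).
rewrite /= fmorphXz nuE; last by apply/eqP; rewrite -(prim_order_dvd pz).
by rewrite exprnP exprz_exp.
Qed.

Lemma gamma_root_sum N d : (0 < d)%N -> (M d %| N)%N -> root_sum N (gamma eps q d).
Proof.
move=> d0 MN; have pz := xi_prim (modulus_gt0 d0).
exists [seq xi (M d) ^ (Q ^+ i) | i : 'I_d]; last by rewrite big_image gammaE.
apply/allP => _ /imageP[i _ ->].
have xN : xi (M d) ^+ N = 1 by apply/eqP; rewrite -(prim_order_dvd pz).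
apply/eqP; transitivity ((xi (M d) ^+ N) ^ (Q ^+ i)); last by rewrite xN exp1rz.
by rewrite [LHS]exprnP [xi _ ^+ N]exprnP !exprz_exp; congr (_ ^ _); apply: mulrC.
Qed.

Definition level := (#|G| * \prod_(d < n) M d.+1)%N.

Lemma level_gt0 : (0 < level)%N.
Proof. by rewrite muln_gt0 cardG_gt0 prodn_gt0 // => d; apply: modulus_gt0. Qed.

Lemma dvd_level d : (1 <= d <= n)%N -> (M d %| level)%N.
Proof.
case: d => // d /andP[_ dn]; rewrite dvdn_mull //.
by rewrite (bigD1 (Ordinal dn)) //= dvdn_mulr.
Qed.

(** When k = Q^j modulo M_d, the conjugate of gamma(d) is the sum over the shifted orbit. *)
Lemma gamma_fixed k (nu : {rmorphism algC -> algC}) : coprime k level ->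
  (forall z, z ^+ level = 1 -> nu z = z ^+ k) ->
  (forall d, (1 <= d <= n)%N -> nu (gamma eps q d) = gamma eps q d) <->
  (forall d, (1 <= d <= n)%N -> exists j, (k%:Z == Q ^+ j %[mod M d])%Z).
Proof.
move=> ck nuE; split=> H d dn.
  apply: (@periods_stab Q n k (fun d => xi (M d))) dn => [|{}d dn].
    have := q_gt1 pF hq e_gt0; case: heps => ->; rewrite ?mul1r ?mulN1r ?abszN //.
  have /andP[d0 _] := dn; split; first exact/xi_prim/modulus_gt0.
    exact: coprime_dvdr (dvd_level dn) ck.
  by rewrite -gammaE -(aut_gamma d0 (dvd_level dn) nuE) H.
have /andP[d0 _] := dn; have [j kj] := H d dn.
rewrite (aut_gamma d0 (dvd_level dn) nuE) gammaE.
have pz := xi_prim (modulus_gt0 d0); set z := xi _ in pz *.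
have M0 := modulus_gt0 d0.
have zu := prim_root_unitr pz.
have zM := prim_expr_order pz.
have Md : (Q ^+ d == 1 %[mod M d])%Z.
  by apply: expz_eq1_modulus.
transitivity (\sum_(i < d) z ^ (Q ^+ (i + j))).
  apply: eq_bigr => i _; apply: (exprz_eqmod zu zM).
  by rewrite -modzMml (eqP kj) modzMml exprD mulrC.
apply: (@sum_periodic _ (fun i => z ^ (Q ^+ i))) => i.
apply: (exprz_eqmod zu zM).
by rewrite exprD -modzMmr (eqP Md) modzMmr mulr1.
Qed.

Lemma conj_power_of_moduli k : coprime k #|G| ->
  (forall d, (1 <= d <= n)%N -> exists j, (k%:Z == Q ^+ j %[mod M d])%Z) ->
  forall g, g \in G -> (g ^+ k)%g \in (g ^: G)%g.
Proof.
move=> ck hk g gG; have gU := (mem_GLeps g heps sE).1 gG.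
have gN : (GLval g : 'M[F]_n) ^+ #[g]%g = 1.
  by have := congr1 val (expg_order g); rewrite FinRing.val_unitX.
have [|T uT gT] := power_similar pF hq heps sE s1 sN (order_gt0 g) gN _ gU hk.
  exact: coprime_dvdr (order_dvdG gG) ck.
apply: (conj_in_GLeps gG (groupX k gG) uT); rewrite gT; congr (_ *m _).
by rewrite -[RHS]/(val (g ^+ k)%g) FinRing.val_unitX.
Qed.

Lemma moduli_of_conj_power k : coprime k level ->
  (forall g, g \in G -> (g ^+ k)%g \in (g ^: G)%g) ->
  forall d, (1 <= d <= n)%N -> exists j, (k%:Z == Q ^+ j %[mod M d])%Z.
Proof.
move=> ck hg d dn; apply: (modulus_of_similar_powers pF hq e_gt0 heps sE sN cardF dn).
  exact: coprime_dvdr (dvd_level dn) ck.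
move=> g ug gU; pose g' : {'GL_n[F]} := FinRing.Unit (ug : (g : 'M[F]_n) \is a GRing.unit).
have gG : g' \in G by apply/(mem_GLeps g' heps sE).
have /imsetP[x xG gx] := hg g' gG.
exists (GLval x : 'M[F]_n); first exact: (valP x).
have : (g' * x = x * g' ^+ k)%g by rewrite gx conjgE !mulgA mulgV mul1g.
by move/(congr1 val); rewrite /= FinRing.val_unitX.
Qed.
End Glue.

Theorem theorem1p1 (p e q : nat) (hp : prime p) (he : (0 < e)%N)
    (hq : q = (p ^ e)%N) (eps : int) (heps : eps = 1 \/ eps = -1)
    (n : nat) (hn : (1 <= n)%N)
    (F : finFieldType) (hF : #|F| = GLeps_card eps q) :
  forall x : algC,
    Qadjoin (char_value (GLeps eps n F q)) x <->
    Qadjoin (fun z => exists d : nat, (1 <= d <= n)%N /\ z = gamma eps q d) x.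
Proof.
case: n hn => // n' _.
have cF : #|F| = if eps == 1 then (p ^ e)%N else (p ^ (e * 2))%N.
  by rewrite hF /GLeps_card hq expnM.
have pF : p \in [pchar F].
  by move: cF; case: ifP => _ cF; apply: (card_finPcharP cF hp).
have [s sE'] := frobenius_power_morphism e pF.
have sE x : s x = x ^+ q by rewrite sE' hq.
have s1 : eps = 1 -> s =1 id.
  by move=> e1 x; rewrite sE -[RHS]expf_card hF e1.
have sN : eps = -1 -> involutive s.
  by move=> e1 x; rewrite !sE -exprM -[RHS]expf_card hF e1.
set G := GLeps eps n'.+1 F q.
have N0 := level_gt0 eps n' pF hq he.
set N := level q eps F n' in N0.
have GN : (#|G| %| N)%N by rewrite dvdn_mulr.
have MN := @dvd_level q eps F n'.
pose chis := [seq 'chi[G]_i g | i <- enum (Iirr G), g <- enum G].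
pose gammas := [seq gamma eps q d.+1 | d : 'I_n'.+1].
have gammasP y : y \in gammas -> exists d : nat, (1 <= d <= n'.+1)%N /\ y = gamma eps q d.
  by case/imageP => d _ ->; exists d.+1; rewrite ltn_ord.
have gammas_in d : (1 <= d <= n'.+1)%N -> gamma eps q d \in gammas.
  by case: d => // d /andP[_ dn]; apply/imageP; exists (Ordinal dn).
have chisP y : y \in chis -> char_value G y.
  by case/allpairsP => [[i g] /= [_ gG ->]]; exists i, g; rewrite -mem_enum.
have chis_in i g : g \in G -> 'chi[G]_i g \in chis.
  by move=> gG; apply: allpairs_f; rewrite mem_enum.
have gamma_rs d : (1 <= d <= n'.+1)%N -> root_sum N (gamma eps q d).
  move=> dn; have /andP[d0 _] := dn.
  exact: (gamma_root_sum pF hq he heps d0 (MN d dn)).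
move=> x; split; apply: Qadjoin_trans => y.
  case=> [i [g [gG ->]]]; apply: (Qadjoin_of_fixed N0 gammasP).
  - by move=> z /gammasP[d [dn ->]]; apply: gamma_rs.
  - exact: char_root_sum.
  move=> nu k ck nuE nug; rewrite (aut_char i GN gG nuE).
  have hk := (gamma_fixed pF hq he heps ck nuE).1 (fun d dn => nug _ (gammas_in d dn)).
  have /imsetP[t tG ->] := conj_power_of_moduli pF hq he heps sE s1 sN hF (coprime_dvdr GN ck) hk gG.
  by rewrite cfunJ.
case=> d [dn ->]; apply: (Qadjoin_of_fixed N0 chisP).
- by move=> z /chisP[i [g [gG ->]]]; apply: char_root_sum.
- exact: gamma_rs.
move=> nu k ck nuE nuchi.
apply: (gamma_fixed pF hq he heps ck nuE).2 => //.
apply: (moduli_of_conj_power pF hq he heps sE sN hF ck) => g gG.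
apply: irr_separates_classes => [||i]; rewrite ?groupX //.
by rewrite -(aut_char i GN gG nuE) nuchi ?chis_in.
Qed.
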